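(* Let $\mathcal F=\{f_i(x)=r_ix+b_i\}_{i=1}^m$ be a non-degenerate reverse iterated function system on $\mathbb Z$ with $|r_i|\in\mathbb Z_{>1}$ and $b_i\in\mathbb Z$, and let $K\subseteq\mathbb Z$ be an invariant set of $\mathcal F$. If $K$ has finite overlaps, then $$\dim_{\mathrm L}K=\dim_{\mathrm{DH}}K=\dim_{\mathrm H}K(\mathcal F^{-1})=\dim_{\mathrm M}K=\dim_{\mathrm{Be}}K=d_{\mathcal F}=s,$$ where $s$ is the unique solution of $\sum_{i=1}^m|r_i|^{-s}=1$.
   Context: The maps $f_1,\dots,f_m$ are distinct. $\mathcal F$ is degenerate if all the maps $f_i$ have a common fixed point, and non-degenerate otherwise. A nonempty set $K$ is invariant under $\mathcal F$ if $K=\bigcup_{i=1}^mf_i(K)$; it has finite overlaps if $f_i(K)\cap f_j(K)$ is finite whenever $i\ne j$. $G^*(\mathcal F)$ is the semigroup of distinct maps generated by $\mathcal F$ under composition (all nonempty finite compositions), $|g'|$ is the absolute value of the linear coefficient of $g$, and $d_{\mathcal F}=\lim_{R\to\infty}\log\#\{g\in G^*(\mathcal F):|g'|\le R\}/\log R$ (this limit always exists). $K(\mathcal F^{-1})\subset\mathbb R$ is the attractor of the contractive iterated function system $\mathcal F^{-1}=\{f_i^{-1}\}_{i=1}^m$, the $f_i$ being regarded as affine maps of $\mathbb R$; $\dim_{\mathrm H}$ is Hausdorff dimension. $\dim_{\mathrm M}E$ is the common value, when they agree, of the $\liminf$ and $\limsup$ as $h\to\infty$ of $\log\#(E\cap[-h,h])/\log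 h$; $\dim_{\mathrm{Be}}E=\limsup_{h\to\infty}\sup_{x\in\mathbb R}\log\#(E\cap[x-h,x+h])/\log h$. Discrete dimensions of subsets of $\mathbb Z$ (Barlow–Taylor): for $x\in\mathbb Z$, $n\in\mathbb Z_{>0}$ let $C(x,n)=\{y\in\mathbb Z:x\le y<x+n\}$, $V(x,n)=\{y\in\mathbb Z:x-n/2\le y<x+n/2\}$, and let $\mathscr C$ be the collection of all $C(x,n)$. For a finite nonempty $A\subset\mathbb Z$ let $d(A)=\min\{r\in\mathbb Z_{>0}:A\subseteq C(x,r)\text{ for some }x\in\mathbb Z\}$. Let $V_n=V(0,2^n)$, $S_1=V_1$, $S_n=V_n\setminus V_{n-1}$ for $n\ge2$. For $A\subseteq\mathbb Z$, finite $F\subset\mathbb Z$ and $\alpha\ge0$ let $$\nu_\alpha(A,F)=\min\Bigl\{\sum_i\Bigl(\frac{d(U_i)}{d(F)}\Bigr)^\alpha:U_i\in\mathscr C,\ A\cap F\subseteq\bigcup_iU_i\Bigr\}.$$ Then $\dim_{\mathrm{DH}}A=\inf\{\alpha\ge0:\sum_{n=1}^\infty\nu_\alpha(A,S_n)<\infty\}$ and $\dim_{\mathrm L}A=\inf\{\alpha\ge0:\lim_{n\to\infty}\nu_\alpha(A,S_n)=0\}$. *)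

(* Defs.v *)
From mathcomp Require Import all_boot all_order all_algebra.
From mathcomp Require Import all_classical all_reals all_analysis.

Set Implicit Arguments.
Unset Strict Implicit.
Unset Printing Implicit Defensive.

Import Order.TTheory GRing.Theory Num.Theory.
Import numFieldNormedType.Exports.

Local Open Scope classical_set_scope.
Local Open Scope ring_scope.

Definition rifs (m : nat) (r b : 'I_m -> int) (i : 'I_m) (x : int) : int :=
  r i * x + b i.

Section SystemsOfMaps.
Context (m : nat) (f : 'I_m -> int -> int).

Definition degenerate : Prop := exists x : int, forall i, f i x = x.

Definition invariant_set (K : set int) : Prop :=
  K !=set0 /\ K = \bigcup_(i : 'I_m) (f i @` K).

Definition finite_overlaps (K : set int) : Prop :=
  forall i j : 'I_m, i != j -> finite_set (f i @` K `&` f j @` K).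

Inductive gen_semigroup : set (int -> int) :=
| gen_base (i : 'I_m) : gen_semigroup (f i)
| gen_comp (g h : int -> int) :
    gen_semigroup g -> gen_semigroup h -> gen_semigroup (g \o h).

(* For an affine map x |-> r * x + b this is r. *)
Definition linear_coef (g : int -> int) : int := g 1 - g 0.

Definition growth_ratio (R : realType) (x : R) : \bar R :=
  (lne (counting
     [set g | gen_semigroup g /\ (`|linear_coef g|%:~R <= x)%R]) / (ln x)%:E)%E.

Definition has_growth_exponent (R : realType) (d : \bar R) : Prop :=
  growth_ratio x @[x --> +oo] --> d.

End SystemsOfMaps.

(* The attractor of the inverse system {x |-> (x - b_i) / r_i} on the line,
   i.e. its (unique) nonempty compact invariant set. *)
Definition is_inverse_attractor (R : realType) (m : nat) (r b : 'I_m -> int)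
    (X : set R) : Prop :=
  [/\ X !=set0, compact X &
      X = \bigcup_(i : 'I_m)
            ((fun x : R => (x - (b i)%:~R) / (r i)%:~R) @` X)].

Definition inverse_attractor {R : realType} (m : nat) (r b : 'I_m -> int) :
  set R := xget set0 [set X | is_inverse_attractor r b X].

Section HausdorffDimension.
Context {R : realType}.
Local Open Scope ereal_scope.

Definition diameter (U : set R) : \bar R :=
  ereal_sup [set `|p.1 - p.2|%:E | p in U `*` U].

(* (diam U)^s; the empty set contributes nothing, even for s = 0. *)
Definition diameter_pow (s : R) (U : set R) : \bar R :=
  if U == set0 then 0 else diameter U `^ s.

Definition hausdorff_premeasure (s delta : R) (E : set R) : \bar R :=
  ereal_inf [set \sum_(0 <= i <oo) diameter_pow s (U i) |
    U in [set U : nat -> set R | E `<=` \bigcup_i U i /\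
            forall i, diameter (U i) <= delta%:E]].

(* The supremum over delta > 0 is the limit as delta tends to 0. *)
Definition hausdorff_measure (s : R) (E : set R) : \bar R :=
  ereal_sup [set hausdorff_premeasure s delta E |
    delta in [set delta : R | (0 < delta)%R]].

Definition hausdorff_dim (E : set R) : \bar R :=
  ereal_inf [set s%:E |
    s in [set s : R | (0 <= s)%R /\ hausdorff_measure s E = 0]].

End HausdorffDimension.

Section MassAndBeurlingDimension.
Context {R : realType} (E : set int).
Local Open Scope ereal_scope.

Definition in_window (u v : R) : set int :=
  E `&` [set k : int | (u <= k%:~R <= v)%R].

Definition mass_ratio (h : R) : \bar R :=
  lne (counting (in_window (- h) h)) / (ln h)%:E.

Definition lower_mass_dim : \bar R := limf_einf mass_ratio +oo%R.

Definition upper_mass_dim : \bar R := limf_esup mass_ratio +oo%R.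

Definition has_mass_dim (d : \bar R) : Prop :=
  lower_mass_dim = d /\ upper_mass_dim = d.

Definition beurling_dim : \bar R :=
  limf_esup (fun h : R =>
    ereal_sup (range (fun x : R =>
      lne (counting (in_window (x - h)%R (x + h)%R)) / (ln h)%:E))) +oo%R.

End MassAndBeurlingDimension.

Definition discr_interval (x : int) (n : nat) : set int :=
  [set y | x <= y < x + n%:Z].

Definition discr_centered (x : int) (n : nat) : set int :=
  [set y | x%:~R - n%:R / 2 <= (y%:~R : rat) < x%:~R + n%:R / 2].

Definition discr_intervals : set (set int) :=
  [set U | exists (x : int) (n : nat), (0 < n)%N /\ U = discr_interval x n].

Definition discr_diam_cands (A : set int) : set nat :=
  [set n | (0 < n)%N /\ exists x : int, A `<=` discr_interval x n].

(* The least candidate; the default 0 is only taken by unbounded sets. *)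
Definition discr_diam (A : set int) : nat :=
  xget 0%N [set n | discr_diam_cands A n /\
                    forall k, discr_diam_cands A k -> (n <= k)%N].

Definition dyadic_window (n : nat) : set int := discr_centered 0 (2 ^ n).

(* Only the indices n >= 1 are meaningful. *)
Definition dyadic_shell (n : nat) : set int :=
  if (n <= 1)%N then dyadic_window 1
  else dyadic_window n `\` dyadic_window n.-1.

Section DiscreteDimensions.
Context {R : realType}.

(* The infimum is attained, hence a minimum.  Finite families suffice since
   every member of a cover contributes at least d(F)^-alpha. *)
Definition discr_content (alpha : R) (A F : set int) : R :=
  inf [set v | exists (k : nat) (U : 'I_k -> set int),
    [/\ forall i, discr_intervals (U i),
        A `&` F `<=` \bigcup_(i : 'I_k) U i &
        v = \sum_(i < k)
              ((discr_diam (U i))%:R / (discr_diam F)%:R) `^ alpha]].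

Definition discr_hausdorff_dim (A : set int) : \bar R :=
  ereal_inf [set alpha%:E | alpha in [set alpha : R | 0 <= alpha /\
    (\sum_(1 <= n <oo) (discr_content alpha A (dyadic_shell n))%:E < +oo)%E]].

Definition discr_lower_dim (A : set int) : \bar R :=
  ereal_inf [set alpha%:E | alpha in [set alpha : R | 0 <= alpha /\
    discr_content alpha A (dyadic_shell n) @[n --> \oo] --> 0]].

End DiscreteDimensions.

(* Main.v *)
Require Import Defs.
From mathcomp Require Import all_boot all_order all_algebra.
From mathcomp Require Import all_classical all_reals all_analysis.
From mathcomp Require Import finmap lra zify ring.

Import Order.TTheory GRing.Theory Num.Theory.
Import numFieldNormedType.Exports.

Local Open Scope classical_set_scope.
Local Open Scope ring_scope.

(** Write [rho_i = |r_i|] and let [s] solve [\sum_i rho_i ^ (- s) = 1].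

    Growth of [K]. Since [K] is the union of the sets [f_i K], the number of its
    points in a window of radius [h] is at most the sum of its numbers of points
    in suitable windows of radius [h / rho_i]; such a recursion forces a bound
    [C h ^ s], uniform in the centre of the window ([nelts_window_le]). For
    windows centred at 0 the finite overlaps give the reverse inequality, up to a
    constant and a bounded change of the radii, and [K] is infinite because the
    system is non-degenerate; this gives a lower bound [c h ^ s]
    ([nelts_window_ge]). The two bounds give the mass
    and Beurling dimensions. For the discrete dimensions, covering [K] by
    singletons handles the exponents above [s]; below [s] the uniform upper bound
    acts as a mass distribution principle ([discr_content_ge]), and the contents of
    the shells cannot tend to 0 as long as the number of points reaches
    [c h ^ s] ([shell_content_ncvg]).

    Growth of the semigroup. If two distinct words gave the same map, cancelling
    their common prefix would give [i <> j] such that [f_i K] and [f_j K] share an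
    infinite image of [K]; hence finite overlaps make the semigroup free
    ([wcomp_free]). Counting maps is then counting words, and the number of words
    of expansion at most [h] satisfies the same recursion exactly
    ([nelts_short_words_bounds]).

    Hausdorff dimension of the attractor [X] of the inverse system. The upper bound
    comes from the covers by cylinders ([hausdorff_measure_attractor]). For the
    lower bound give the cylinder of a word [w] the mass [|f_w'| ^ (- s)]. A ball
    of radius about [2 ^ (- k)] is met by cylinders of comparable size along words
    [u] for which the corresponding map of the system sends the centre of the ball
    into a fixed bounded set. Such a map is determined by its linear coefficient,
    which depends only on the numbers of occurrences of the letters, and by its
    constant term, an integer in an interval of bounded length. By freeness there
    are therefore only polynomially many such words in [k]
    ([size_bounded_words]). So the mass of a ball is at most [C] times its radius
    to the power [t], for every [t < s] ([ball_mass]), and the attractor, being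
    compact, has dimension at least [t] ([hausdorff_measure_neq0]). No separation
    condition is needed: the polynomial factor does not affect the exponent. *)

(** * Counting elements of finite sets *)

(** The number of elements of a finite set; an infinite set gets 0. *)
Definition nelts {T : choiceType} (A : set T) : nat := #|` fset_set A|%fset.

Lemma nelts_sum (T : choiceType) (U A : set T) : finite_set U -> A `<=` U ->
  nelts A = (\sum_(x <- fset_set U) (x \in A))%N.
Proof.
move=> finU AU; have finA : finite_set A by exact: sub_finite_set finU.
rewrite /nelts card_fset_sum1.
transitivity (\sum_(x <- fset_set A) (x \in A))%N.
  rewrite big_seq [RHS]big_seq; apply: eq_bigr => x.
  by rewrite in_fset_set// => ->.
apply: big_fset_incl => [|x _].
  by rewrite -fset_set_sub.
by rewrite in_fset_set// => /negbTE ->.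
Qed.

Lemma nelts_subset (T : choiceType) (A B : set T) : finite_set B ->
  A `<=` B -> (nelts A <= nelts B)%N.
Proof.
move=> finB AB; have finA : finite_set A by exact: sub_finite_set finB.
by apply: fsubset_leq_card; rewrite -fset_set_sub.
Qed.

Lemma nelts_image (T U : choiceType) (f : T -> U) (A : set T) :
  finite_set A -> injective f -> nelts (f @` A) = nelts A.
Proof.
by move=> finA f_inj; rewrite /nelts fset_set_image// card_imfset.
Qed.

Lemma nelts_image_le (T U : choiceType) (f : T -> U) (A : set T) :
  finite_set A -> (nelts (f @` A) <= nelts A)%N.
Proof.
by move=> finA; rewrite /nelts fset_set_image//; exact: leq_imfset_card.
Qed.

Lemma nelts_II n : nelts `I_n = n.
Proof. by apply/card_fset_set/card_eqxx. Qed.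

Lemma nelts1 (T : choiceType) (x : T) : nelts [set x] = 1%N.
Proof. by rewrite /nelts fset_set1 cardfs1. Qed.

Lemma nelts_bigcup_le (T : choiceType) m (S : 'I_m -> set T) (A : set T) :
  (forall i, finite_set (S i)) -> A `<=` \bigcup_i S i ->
  (nelts A <= \sum_(i < m) nelts (S i))%N.
Proof.
move=> finS AS.
have finU : finite_set (\bigcup_i S i).
  by apply: bigcup_finite => [|i _]; [exact: finite_finset|].
apply: (leq_trans (nelts_subset _ _ _ finU AS)).
under eq_bigr => i _ do rewrite (nelts_sum _ _ _ finU (bigcup_sup (i := i) _))//.
rewrite exchange_big /= (nelts_sum _ (\bigcup_i S i))//.
apply: leq_sum => x _; case: (boolP (x \in \bigcup_i S i)) => // /set_mem[i _ Six].
by rewrite (bigD1 i)//= mem_set.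
Qed.

(** If the pairwise overlaps of [m] finite sets lie in a finite set [O], the
    sum of their numbers of elements exceeds that of their union by at most [m]
    times that of [O]. *)
Lemma sum_nelts_le (T : choiceType) m (S : 'I_m -> set T) (A O : set T) :
  finite_set A -> finite_set O -> (forall i, S i `<=` A) ->
  (forall i j, i != j -> S i `&` S j `<=` O) ->
  (\sum_(i < m) nelts (S i) <= nelts A + m * nelts O)%N.
Proof.
move=> finA finO SA SO.
have finU : finite_set (A `|` O) by rewrite finite_setU.
have SU i : S i `<=` A `|` O by move=> x /SA; left.
have AU : A `<=` A `|` O by left.
have OU : O `<=` A `|` O by right.
under eq_bigr => i _ do rewrite (nelts_sum _ _ _ finU (SU i)).
rewrite exchange_big /= (nelts_sum _ _ _ finU AU) (nelts_sum _ _ _ finU OU).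
rewrite big_distrr -big_split /=; apply: leq_sum => x _.
have [xO|xO] := boolP (x \in O).
  rewrite muln1 addnC; apply: leq_trans (leq_addr _ _).
  apply: (@leq_trans (\sum_(i < m) 1)%N).
    by apply: leq_sum => i _; case: (_ \in _).
  by rewrite sum1_card card_ord.
rewrite muln0 addn0.
have [|] := pselect (exists i, S i x) => [[i Six]|nS].
  rewrite (bigD1 i)//= (mem_set (SA _ _ Six)) (mem_set Six).
  rewrite big1// => j ji; apply/eqP; rewrite eqb0; apply/negP => /set_mem Sjx.
  by move/negP: xO; apply; apply/mem_set/(SO _ _ ji).
rewrite big1// => i _; apply/eqP; rewrite eqb0; apply/negP => /set_mem Six.
by apply: nS; exists i.
Qed.

(** The same for pairwise disjoint sets. *)
Lemma sum_nelts_disjoint (T : choiceType) m (S : 'I_m -> set T) (A : set T) :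
  finite_set A -> (forall i, S i `<=` A) ->
  (forall i j, i != j -> S i `&` S j = set0) ->
  (\sum_(i < m) nelts (S i) <= nelts A)%N.
Proof.
move=> finA SA S0.
have -> : nelts A = (nelts A + m * nelts (@set0 T))%N.
  by rewrite /nelts fset_set0 cardfs0 muln0 addn0.
by apply: sum_nelts_le => // i j ij x; rewrite S0.
Qed.

Lemma countingE (R : realType) (T : choiceType) (A : set T) : finite_set A ->
  counting A = (nelts A)%:R%:E :> \bar R.
Proof. by move=> finA; rewrite /counting asboolT. Qed.

(** * Functional inequalities *)

Section Recursion.
Context {R : realType} {m : nat} (rho : 'I_m -> R) (s rmax : R).
Context (rho_ge2 : forall i, 2 <= rho i) (rho_le : forall i, rho i <= rmax).
Context (s_ge0 : 0 <= s) (rmax_ge1 : 1 <= rmax)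
  (rho_s : \sum_(i < m) rho i `^ (- s) = 1).

Let rho_gt0 i : 0 < rho i. Proof. by apply: lt_le_trans (rho_ge2 i). Qed.
Let rmax_gt0 : 0 < rmax. Proof. exact: lt_le_trans rmax_ge1. Qed.

(** The function [h |-> (a * h) `^ s] solves the recursion exactly. *)
Lemma sum_powR_div (a h : R) : 0 <= a -> 0 <= h ->
  \sum_(i < m) (a * (h / rho i)) `^ s = (a * h) `^ s.
Proof.
move=> a0 h0; rewrite -[RHS]mulr1 -rho_s big_distrr; apply: eq_bigr => i _ /=.
rewrite mulrA powRM ?mulr_ge0 ?invr_ge0 ?(ltW (rho_gt0 i))//.
by rewrite powRN -powR_inv1 ?(ltW (rho_gt0 i))// -powRrM mulN1r powRN.
Qed.

Let exp2_ge (h : R) : exists n : nat, h < 2 ^+ n.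
Proof.
exists (Num.trunc `|h|).+1; apply: le_lt_trans (ler_norm _) _.
apply: lt_le_trans (truncnS_gt _) _.
by rewrite -natrX ler_nat ltnW// ltn_expl.
Qed.

(** A family of functions dominated by the sum of its values at the points
    [h / rho i] grows at most like [h `^ s]. *)
Lemma subrecursion_le (X : Type) (M : X -> R -> R) (C0 : R) : 0 <= C0 ->
  (forall x h, h < 1 -> M x h <= C0) ->
  (forall x h, 1 <= h -> exists y : 'I_m -> X,
      M x h <= \sum_(i < m) M (y i) (h / rho i)) ->
  forall x h, rmax^-1 <= h -> M x h <= C0 * (rmax * h) `^ s.
Proof.
move=> C0_ge0 base step x h hr.
have [n hn] := exp2_ge h.
elim: n x h hr hn => [|n IH] x h hr hn.
  apply: le_trans (base _ _ hn) _; rewrite ler_peMr//.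
  rewrite -(powRr0 (rmax * h)) ler_powR//.
  by rewrite -ler_pdivrMl// mulr1.
have h0 : 0 < h by apply: lt_le_trans hr; rewrite invr_gt0.
have [h1|h1] := ltP h 1.
  apply: le_trans (base _ _ h1) _; rewrite ler_peMr//.
  rewrite -(powRr0 (rmax * h)) ler_powR//.
  by rewrite -ler_pdivrMl// mulr1.
have [y My] := step x h h1; apply: le_trans My _.
rewrite -sum_powR_div ?(ltW h0) ?(ltW rmax_gt0)// mulr_sumr.
apply: ler_sum => i _; apply: IH.
  rewrite ler_pdivlMr// -ler_pdivlMl ?invr_gt0// invrK.
  by apply: le_trans (rho_le i) _; rewrite ler_peMr// ltW.
rewrite ltr_pdivrMr//; apply: lt_le_trans hn _.
by rewrite exprSr ler_pM2l// exprn_gt0.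
Qed.

(** A function dominating the sum of its values at the points [h / rho i] grows
    at least like [h `^ s]. *)
Lemma superrecursion_ge (M : R -> R) (c0 h1 : R) : 0 < h1 -> 0 <= c0 ->
  (forall h, h1 <= h -> c0 <= M h) ->
  (forall h, h1 * rmax <= h -> \sum_(i < m) M (h / rho i) <= M h) ->
  forall h, h1 <= h -> c0 * ((h1 * rmax)^-1 * h) `^ s <= M h.
Proof.
move=> h1_gt0 c0_ge0 base step h hh.
have [n hn] := exp2_ge (h / h1).
have hr : 0 < h1 * rmax by rewrite mulr_gt0.
elim: n h hh hn => [|n IH] h hh hn.
  by move: hn; rewrite ltr_pdivrMr// mul1r ltNge hh.
have h0 : 0 < h by apply: lt_le_trans hh.
have [hl|hl] := leP (h1 * rmax) h; last first.
  apply: le_trans (base _ hh); rewrite ler_piMr//.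
  apply: (@le_trans _ _ (1 `^ s)); last by rewrite powR1.
  apply: ge0_ler_powR => //; rewrite ?nnegrE ?ler01//.
    by rewrite mulr_ge0 ?invr_ge0 ?ltW.
  by rewrite ler_pdivrMl// mulr1 ltW.
apply: le_trans (step _ hl).
rewrite -sum_powR_div ?(ltW h0) ?invr_ge0 ?(ltW hr)// mulr_sumr.
apply: ler_sum => i _; apply: IH.
  rewrite ler_pdivlMr//; apply: le_trans hl.
  by rewrite ler_pM2l.
rewrite mulrAC ltr_pdivrMr//; apply: lt_le_trans hn _.
by rewrite exprSr ler_pM2l// exprn_gt0.
Qed.

End Recursion.

(** * Words and the affine maps they define *)

Section System.
Context {m : nat} (r b : 'I_m -> int).
Context (r_gt1 : forall i, 1 < `|r i|).

(** The composition of the maps of the system along a word, the first letter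
    being applied last. *)
Definition wcomp (u : seq 'I_m) (x : int) : int := foldr (rifs r b) x u.

(** The linear coefficient of [wcomp u]. *)
Definition slope (u : seq 'I_m) : int := \prod_(i <- u) r i.

Lemma wcompE u x : wcomp u x = slope u * x + wcomp u 0.
Proof.
rewrite /wcomp /slope; elim: u => [|i u IH] /=; first by rewrite big_nil mul1r addr0.
by rewrite big_cons {1}/rifs IH /rifs mulrDr addrA mulrA.
Qed.

Lemma linear_coef_wcomp u : linear_coef (wcomp u) = slope u.
Proof. by rewrite /linear_coef (wcompE u 1) mulr1 addrK. Qed.

Lemma wcomp_cat u v x : wcomp (u ++ v) x = wcomp u (wcomp v x).
Proof. by rewrite /wcomp foldr_cat. Qed.

Lemma slope_cons i u : slope (i :: u) = r i * slope u.
Proof. by rewrite /slope big_cons. Qed.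

Lemma slope_rev u : slope (rev u) = slope u.
Proof. by rewrite /slope; apply: perm_big; rewrite perm_rev. Qed.

Lemma norm_slope_ge u : 2 ^+ size u <= `|slope u|.
Proof.
elim: u => [|i u IH]; first by rewrite /slope big_nil normr1.
rewrite slope_cons normrM exprS; apply: ler_pM => //; exact: r_gt1.
Qed.

Lemma slope_neq0 u : slope u != 0.
Proof.
rewrite -normr_gt0; apply: lt_le_trans (norm_slope_ge u).
by rewrite exprn_gt0.
Qed.

Lemma wcomp_inj u : injective (wcomp u).
Proof.
move=> x y; rewrite (wcompE u x) (wcompE u y) => /addIr.
by apply: mulfI; exact: slope_neq0.
Qed.

Lemma rifs_inj i : injective (rifs r b i).
Proof. exact: (@wcomp_inj [:: i]). Qed.

(** Displacements are multiplied by [r i] along an orbit of [f_i]. *)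
Lemma rifs_displacement i x :
  rifs r b i (rifs r b i x) - rifs r b i x = r i * (rifs r b i x - x).
Proof. by rewrite /rifs; ring. Qed.

Context (K : set int) (K_invariant : invariant_set (rifs r b) K).

Lemma wcomp_invariant u x : K x -> K (wcomp u x).
Proof.
move=> Kx; elim: u => // i u IH /=.
by case: K_invariant => _ ->; exists i => //; exists (wcomp u x).
Qed.

Context (f_nondegenerate : ~ degenerate (rifs r b)).

(** With a single map, the displacement of a point would be a multiple of that
    of its preimage, and so on without end. *)
Lemma system_size_gt1 : (1 < m)%N.
Proof.
case: K_invariant => -[x Kx] KE.
have pre y : K y -> exists i z, K z /\ rifs r b i z = y.
  by rewrite KE => -[i _ [z Kz <-]]; exists i, z; rewrite -KE.
rewrite ltnNge; apply/negP => m1.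
have single (i j : 'I_m) : i = j.
  by apply: ord_inj; have := ltn_ord i; have := ltn_ord j; lia.
have [i0 _] := pre x Kx.
have [n] := ubnP `|rifs r b i0 x - x|%N.
elim: n x Kx => // n IH x Kx; rewrite ltnS => lt_n.
have [i [y [Ky yx]]] := pre x Kx.
rewrite (single i i0) in yx.
apply: (IH y Ky); apply: leq_trans lt_n.
rewrite -{1 2}yx rifs_displacement abszM.
have : (0 < `|rifs r b i0 y - y|)%N.
  rewrite absz_gt0 subr_eq0; apply/eqP => fy; apply: f_nondegenerate.
  by exists y => i'; rewrite (single i' i0).
have := r_gt1 i0; nia.
Qed.

(** A point of [K] moved by some [f_i] has an infinite orbit. *)
Lemma invariant_sequence : exists2 z : nat -> int, injective z & forall n, K (z n).
Proof.
case: K_invariant => -[x Kx] _.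
have [i fx] : exists i, rifs r b i x <> x.
  by apply/existsNP => fx; apply: f_nondegenerate; exists x.
pose z n := wcomp (nseq n i) x.
pose d n := `|rifs r b i (z n) - z n|%N.
have dS n : (d n < d n.+1)%N.
  have dn : (0 < d n)%N.
    rewrite absz_gt0 subr_eq0; elim: n => [|n IH]; first exact/eqP.
    by rewrite (inj_eq (@rifs_inj i)).
  rewrite /d /= rifs_displacement abszM -/(d n).
  have := r_gt1 i; nia.
exists z => [n n' zn|n]; last exact: wcomp_invariant.
have d_mono : {mono d : n n' / (n <= n')%N}.
  by apply: leq_mono; apply: homo_ltn => //; exact: ltn_trans.
by apply: (incn_inj d_mono); rewrite /d zn.
Qed.

Lemma invariant_infinite : infinite_set K.
Proof.
have [z z_inj Kz] := invariant_sequence.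
move=> finK; have := nelts_image _ _ z `I_(nelts K).+1 (finite_II _) z_inj.
rewrite nelts_II; apply/eqP; rewrite neq_ltn ltnS.
by rewrite nelts_subset// => _ [n _ <-].
Qed.

Context (K_overlaps : finite_overlaps (rifs r b) K).

(** Finite overlaps make the system free: two words defining the same map
    have, after removal of their common prefix, distinct first letters [i] and
    [j], and then [f_i K] and [f_j K] share an infinite image of [K]. *)
Lemma wcomp_free : injective wcomp.
Proof.
have nontrivial i u : wcomp (i :: u) <> wcomp [::].
  move=> e; have /eqP : `|slope (i :: u)| = 1.
    by rewrite -linear_coef_wcomp e linear_coef_wcomp /slope big_nil normr1.
  by apply/negP; rewrite neq_lt orbC (lt_le_trans _ (norm_slope_ge _))// exprn_egt1.
elim=> [|i u IH] [|j v]//.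
- by move/esym/nontrivial.
- by move/nontrivial.
move=> e; have [ij|ij] := eqVneq i j.
  rewrite -ij in e *; congr (_ :: _); apply: IH; apply/funext => x.
  by apply: (@rifs_inj i); have := congr1 (@^~ x) e.
exfalso; have : finite_set (wcomp (i :: u) @` K).
  apply: sub_finite_set (K_overlaps i j ij) => _ [x Kx <-]; split.
    by exists (wcomp u x) => //; exact: wcomp_invariant.
  by rewrite e; exists (wcomp v x) => //; exact: wcomp_invariant.
move=> finuK; apply: invariant_infinite.
set g := wcomp (i :: u) in finuK.
have /finite_preimage : {in g @^-1` (g @` K) &, injective g}.
  by move=> ? ? _ _; exact: wcomp_inj.
by move=> /(_ finuK); apply: sub_finite_set => x Kx; exists x.
Qed.

End System.

(** * The similarity dimension *)

Section SimilarityDimension.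
Context {R : realType} {m : nat} (rho : 'I_m -> R).
Context (rho_ge2 : forall i, 2 <= rho i) (m_gt1 : (1 < m)%N).

Let rho_gt1 i : 1 < rho i. Proof. by apply: lt_le_trans (rho_ge2 i); lra. Qed.
Let rho_gt0 i : 0 < rho i. Proof. by apply: lt_le_trans (rho_ge2 i). Qed.

Let powR_exp i t : rho i `^ (- t) = expR (- t * ln (rho i)).
Proof. by rewrite /powR gt_eqF. Qed.

Lemma sum_powRN_decreasing (t t' : R) : t < t' ->
  \sum_(i < m) rho i `^ (- t') < \sum_(i < m) rho i `^ (- t).
Proof.
move=> tt'; have i0 : 'I_m by apply: (Ordinal (ltnW m_gt1)).
apply: ltr_sum => [|i _].
  by apply/hasP; exists i0 => //; rewrite mem_index_enum.
by rewrite !powR_exp ltr_expR ltr_pM2r ?ltrN2// ln_gt0.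
Qed.

Lemma sum_powRN_continuous : continuous (fun t : R => \sum_(i < m) rho i `^ (- t)).
Proof.
apply: continuous_big => [|i _ t]; first exact: add_continuous.
rewrite (_ : (fun t => _) = expR \o (fun t => - t * ln (rho i))); last first.
  by apply/funext => t'; exact: powR_exp.
apply: continuous_comp; last exact: continuous_expR.
by apply: cvgM; [apply: cvgN; exact: cvg_id|exact: cvg_cst].
Qed.

Lemma similarity_dimension : exists s : R, 0 < s /\
  unique (fun t : R => \sum_(i < m) rho i `^ (- t) = 1) s.
Proof.
have [|||s s0 phis] := @IVT R (fun t => \sum_(i < m) rho i `^ (- t)) 0 m%:R 1.
- by [].
- by apply: continuous_subspaceT; exact: sum_powRN_continuous.
- have phi0 : \sum_(i < m) rho i `^ (- 0) = m%:R.
    under eq_bigr do rewrite oppr0 powRr0.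
    by rewrite sumr_const card_ord.
  have phim : \sum_(i < m) rho i `^ (- m%:R) <= 1.
    apply: (@le_trans _ _ (\sum_(i < m) (2 ^+ m)^-1)).
      apply: ler_sum => i _; rewrite powR_invn ?(ltW (rho_gt0 i))//.
      rewrite lef_pV2 ?posrE ?exprn_gt0//.
      by rewrite lerXn2r// ?nnegrE// ltW.
    rewrite sumr_const card_ord -[leLHS]mulr_natl ler_pdivrMr ?exprn_gt0// mul1r.
    by rewrite -natrX ler_nat ltnW// ltn_expl.
  rewrite phi0 ge_min phim orbT le_max ler1n /=.
  by rewrite (ltnW m_gt1).
exists s; split.
  rewrite lt_neqAle; move: s0; rewrite in_itv /= => /andP[-> _]; rewrite andbT.
  apply/eqP => s0; move: phis; rewrite -s0.
  under eq_bigr do rewrite oppr0 powRr0.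
  rewrite sumr_const card_ord => /eqP; rewrite (eqr_nat R m 1).
  by rewrite gtn_eqF.
split=> // t phit; apply/eqP; rewrite eq_le !leNgt.
by apply/andP; split; apply/negP => /sum_powRN_decreasing; rewrite phis phit ltxx.
Qed.

End SimilarityDimension.

(** * Growth of the number of points of an invariant set *)

Section Windows.
Context {R : realType}.
Implicit Types (E : set int) (u v : R).

Lemma in_window_sub E u v n : v - u + 1 <= n%:R ->
  in_window E u v `<=` [set Num.floor u + k%:Z | k in `I_n].
Proof.
move=> uvn k [_ /= /andP[uk kv]].
have fk : Num.floor u <= k by rewrite -(@intrKfloor R k); exact: le_floor.
exists `|k - Num.floor u|%N => /=; last by lia.
rewrite -(ltr_nat R) natr_absz ger0_norm ?subr_ge0//.
rewrite rmorphB /=; have := floorD1_gt u; rewrite rmorphD /=; lra.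
Qed.

Lemma finite_in_window E u v : finite_set (in_window E u v).
Proof.
apply: (sub_finite_set (in_window_sub E u v (Num.trunc (v - u + 1)).+1 _)).
  exact: ltW (truncnS_gt _).
exact/finite_image/finite_II.
Qed.

Lemma nelts_in_window E u v n : v - u + 1 <= n%:R ->
  (nelts (in_window E u v) <= n)%N.
Proof.
move=> /in_window_sub sub; rewrite -[leqRHS](nelts_II n).
apply: leq_trans (nelts_image_le _ _ _ _ (finite_II _)).
by apply: nelts_subset (sub E); exact/finite_image/finite_II.
Qed.

Lemma in_windowP E (x h : R) k :
  in_window E (x - h) (x + h) k <-> E k /\ `|k%:~R - x| <= h.
Proof. by rewrite /in_window ler_distl. Qed.

End Windows.

Section Expansion.
Context (R : realType) {m : nat} (r : 'I_m -> int).
Context (r_gt1 : forall i, 1 < `|r i|).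

Lemma expansion_ge2 i : 2 <= `|r i|%:~R :> R.
Proof. by rewrite -[2]/(2%:~R) ler_int; have := r_gt1 i; lia. Qed.

Lemma expansion_le_sum i : `|r i|%:~R <= \sum_(i < m) `|r i|%:~R :> R.
Proof. by rewrite (bigD1 i)//= lerDl; apply: sumr_ge0 => j _; rewrite ler0z. Qed.

End Expansion.

Section Growth.
Context {R : realType} {m : nat} (r b : 'I_m -> int) (K : set int) (s : R).
Context (r_gt1 : forall i, 1 < `|r i|).
Context (K_invariant : invariant_set (rifs r b) K).
Context (f_nondegenerate : ~ degenerate (rifs r b)).
Context (K_overlaps : finite_overlaps (rifs r b) K).
Context (s_gt0 : 0 < s) (s_eq : \sum_(i < m) (`|r i|%:~R : R) `^ (- s) = 1).

(** The expansion ratios as real numbers, and an upper bound for them. *)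
Let rho (i : 'I_m) : R := `|r i|%:~R.
Let rmax : R := \sum_(i < m) rho i.

Let rho_ge2 i : 2 <= rho i. Proof. exact: expansion_ge2. Qed.
Let rho_gt0 i : 0 < rho i. Proof. exact: lt_le_trans (rho_ge2 i). Qed.
Let rho_le_sum i : rho i <= rmax. Proof. exact: expansion_le_sum. Qed.

Let m_gt1 : (1 < m)%N := system_size_gt1 r b r_gt1 K K_invariant f_nondegenerate.
Let i0 : 'I_m := Ordinal (ltnW m_gt1).

Let rmax_ge1 : 1 <= rmax.
Proof. by apply: le_trans (rho_le_sum i0); apply: le_trans (rho_ge2 i0); lra. Qed.

(** Uniform upper bound: [K] is the union of the sets [f_i K], and [f_i] maps
    a window of [K] of radius [h / rho i] onto the part of [f_i K] lying in a
    window of radius [h]. *)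
Lemma nelts_window_le : exists2 C : R, 0 < C & forall x h, 1 <= h ->
  (nelts (in_window K (x - h) (x + h)))%:R <= C * h `^ s.
Proof.
have rmax_gt0 : 0 < rmax by exact: lt_le_trans rmax_ge1.
exists (3 * rmax `^ s); first by rewrite mulr_gt0// powR_gt0.
move=> x h h1; rewrite -mulrA -powRM ?(ltW rmax_gt0) ?(le_trans ler01 h1)//.
apply: (subrecursion_le rho s rmax rho_ge2 rho_le_sum (ltW s_gt0) rmax_ge1 s_eq
  R (fun x h => (nelts (in_window K (x - h) (x + h)))%:R)) => //.
- move=> {h1}x {}h h1; rewrite (ler_nat _ _ 3); apply: nelts_in_window; lra.
- move=> {h1}x {}h h1; pose y i : R := (x - (b i)%:~R) / (r i)%:~R; exists y.
  rewrite -natr_sum ler_nat.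
  pose S i := rifs r b i @` in_window K (y i - h / rho i) (y i + h / rho i).
  apply: (@leq_trans (\sum_(i < m) nelts (S i))%N).
    apply: nelts_bigcup_le => [i|k /in_windowP[Kk kx]].
      exact/finite_image/finite_in_window.
    case: K_invariant Kk => _ -> [i _ [j Kj jk]]; exists i => //; exists j => //.
    apply/in_windowP; split=> //; rewrite ler_pdivlMr ?rho_gt0//.
    have r0 : (r i)%:~R != 0 :> R.
      by rewrite intr_eq0; have := r_gt1 i; apply: contraTneq => ->.
    rewrite /rho intr_norm -normrM; apply: le_trans kx.
    rewrite -jk /rifs /y rmorphD rmorphM /= mulrBl divfK//.
    by rewrite le_eqVlt; apply/orP; left; apply/eqP; congr `|_|; ring.
  apply: leq_sum => i _; apply: nelts_image_le; exact: finite_in_window.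
- apply: le_trans h1; rewrite invf_le1// (lt_le_trans ltr01)//.
Qed.

(** Finite overlaps make the recursion an inequality in the other direction, up
    to a constant; as [K] is infinite the constant is harmless. *)
Lemma nelts_window_ge : exists2 c : R, 0 < c &
  \forall h \near +oo, c * h `^ s <= (nelts (in_window K (- h) h))%:R.
Proof.
pose N (h : R) := nelts (in_window K (- h) h).
pose beta : R := \sum_(i < m) `|b i|%:~R.
have beta_ge i : `|b i|%:~R <= beta.
  by rewrite /beta (bigD1 i)//= lerDl; apply: sumr_ge0 => j _; rewrite ler0z.
have beta_ge0 : 0 <= beta by apply: sumr_ge0 => j _; rewrite ler0z.
pose O := \bigcup_(p : 'I_m * 'I_m)
   if p.1 == p.2 then set0 else rifs r b p.1 @` K `&` rifs r b p.2 @` K.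
have finO : finite_set O.
  apply: bigcup_finite => [|[i j] _ /=]; first exact: finite_finset.
  by case: eqVneq => [_|ij]; [exact: finite_set0|exact: K_overlaps].
have winP k (h : R) : in_window K (- h) h k <-> K k /\ `|k%:~R| <= h.
  by rewrite /in_window /= ler_norml.
(* f_i maps the window of radius h / rho i - beta into that of radius h - beta *)
have step h : (\sum_(i < m) N (h / rho i - beta)%R <= N (h - beta)%R + m * nelts O)%N.
  pose S i := rifs r b i @` in_window K (- (h / rho i - beta)) (h / rho i - beta).
  apply: (@leq_trans (\sum_(i < m) nelts (S i))%N).
    apply: leq_sum => i _; rewrite nelts_image//; first exact: finite_in_window.
    exact: rifs_inj.
  apply: sum_nelts_le => //; first exact: finite_in_window.
    move=> i _ [k /winP[Kk kh] <-]; apply/winP; split.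
      by case: K_invariant => _ ->; exists i => //; exists k.
    rewrite /rifs rmorphD rmorphM /=; apply: le_trans (ler_normD _ _) _.
    rewrite normrM -!intr_norm -/(rho i).
    have : `|k%:~R| * rho i <= (h / rho i - beta) * rho i.
      by rewrite ler_pM2r ?rho_gt0.
    rewrite mulrBl divfK ?gt_eqF ?rho_gt0// intr_norm => H1.
    have := beta_ge i; rewrite intr_norm => H2.
    have := rho_ge2 i; nra.
  move=> i j ij k [[k1 /winP[K1 _] e1] [k2 /winP[K2 _] e2]].
  exists (i, j) => //=; rewrite (negbTE ij); split; [by exists k1|by exists k2].
(* subtracting c0 absorbs the overlaps in the recursion *)
pose c0 : R := (m * nelts O)%:R / (m%:R - 1).
have m1 : 0 < m%:R - 1 :> R by rewrite subr_gt0 ltr1n.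
pose M h : R := (N (h - beta))%:R - c0.
have Mstep h : \sum_(i < m) M (h / rho i) <= M h.
  rewrite /M sumrB -natr_sum sumr_const card_ord -[c0 *+ m]mulr_natl.
  have -> : m%:R * c0 = (m * nelts O)%:R + c0 by rewrite /c0; field; rewrite gt_eqF.
  by have := step h; rewrite -(ler_nat R) natrD; lra.
(* the window of radius H contains enough points of an infinite sequence *)
have [H H0 MH] : exists2 H : R, 0 < H & forall h, H <= h -> 1 <= M h.
  have [z z_inj Kz] := invariant_sequence r b r_gt1 K K_invariant f_nondegenerate.
  pose n := (Num.trunc (c0 + 1)).+1.
  pose H : R := (\sum_(k < n) `|z k|)%:~R.
  exists (H + beta + 1).
    by rewrite ltr_wpDl// addr_ge0// ler0z sumr_ge0.
  move=> h Hh; rewrite /M lerBrDl; apply: (@le_trans _ _ n%:R).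
    exact: ltW (truncnS_gt _).
  rewrite ler_nat -[leqLHS](nelts_II n) -(nelts_image _ _ z `I_n (finite_II _) z_inj).
  apply: nelts_subset; first exact: finite_in_window.
  move=> _ [k /= kn <-]; apply/winP; split=> //.
  apply: (@le_trans _ _ H); last by lra.
  rewrite -intr_norm ler_int (bigD1 (Ordinal kn))//= lerDl sumr_ge0//.
have := @superrecursion_ge R m rho s rmax rho_ge2 rho_le_sum (ltW s_gt0) rmax_ge1
  s_eq M 1 H H0 ler01 MH (fun h _ => Mstep h).
set a := (H * rmax)^-1 => ge.
have a0 : 0 < a by rewrite invr_gt0 mulr_gt0// (lt_le_trans ltr01).
exists (a `^ s); first exact: powR_gt0.
near=> h; have h0 : 0 < h by near: h; exact: nbhs_pinfty_gt.
have Hh : H <= h by near: h; apply: nbhs_pinfty_ge; rewrite num_real.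
rewrite -powRM ?(ltW a0) ?(ltW h0)// -[leLHS]mul1r.
apply: le_trans (ge h Hh) _; rewrite /M.
have c0_ge0 : 0 <= c0 by rewrite /c0 divr_ge0// ltW.
apply: (@le_trans _ _ (N (h - beta))%:R); first by rewrite gerBl.
rewrite ler_nat; apply: nelts_subset; first exact: finite_in_window.
move=> k /winP[Kk kh]; apply/winP; split=> //; apply: le_trans kh _.
by rewrite gerBl.
Unshelve. all: by end_near. Qed.

(** The set of words along which the expansion is at most [h]. *)
Definition short_words (h : R) : set (seq 'I_m) :=
  [set u | `|slope r u|%:~R <= h].

Lemma finite_short_words h : finite_set (short_words h).
Proof.
have fin n : finite_set [set u : seq 'I_m | (size u < n)%N].
  elim: n => [|n IH].
    by rewrite (_ : [set _ | _] = set0)// -subset0.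
  apply: (@sub_finite_set _ _ ([set [::]] `|` \bigcup_i
    (cons i @` [set u : seq 'I_m | (size u < n)%N]))).
    by move=> [|i u] /= un; [left|right; exists i => //; exists u].
  rewrite finite_setU; split; first exact: finite_set1.
  by apply: bigcup_finite => [|i _]; [exact: finite_finset|exact: finite_image].
apply: sub_finite_set (fin (Num.trunc h).+1) => u /= uh.
rewrite -(ltr_nat R); apply: le_lt_trans (truncnS_gt h).
apply: le_trans uh; apply: (@le_trans _ _ (2 ^ size u)%N%:R).
  by rewrite ler_nat ltnW// ltn_expl.
by rewrite natrX -[2]/(2%:~R) -rmorphXn /= ler_int norm_slope_ge.
Qed.

Lemma nelts_short_words h : 1 <= h ->
  nelts (short_words h) = (1 + \sum_(i < m) nelts (short_words (h / rho i)%R))%N.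
Proof.
move=> h1.
pose S (k : 'I_m.+1) : set (seq 'I_m) :=
  if unlift ord0 k is Some i then cons i @` short_words (h / rho i) else [set [::]].
have -> : (1 + \sum_(i < m) nelts (short_words (h / rho i)%R))%N =
    (\sum_(k < m.+1) nelts (S k))%N.
  rewrite big_ord_recl; congr (_ + _)%N; first by rewrite /S unlift_none nelts1.
  apply: eq_bigr => i _; rewrite /S liftK nelts_image//.
    exact: finite_short_words.
  by move=> u v [].
have consE i u : short_words h (i :: u) <-> short_words (h / rho i) u.
  rewrite /short_words /= ler_pdivlMr ?rho_gt0//.
  by rewrite slope_cons normrM mulrC rmorphM.
apply/eqP; rewrite eqn_leq; apply/andP; split.
  apply: nelts_bigcup_le => [k|[|i u] hu].
    rewrite /S; case: unliftP => [i _|_]; last exact: finite_set1.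
    exact/finite_image/finite_short_words.
  - by exists ord0; rewrite //= /S unlift_none.
  - by exists (lift ord0 i); rewrite //= /S liftK; exists u => //; apply/consE.
apply: sum_nelts_disjoint; first exact: finite_short_words.
  move=> k; rewrite /S; case: unliftP => [i _ _ [u hu <-]|_ _ ->]; first exact/consE.
  by rewrite /short_words /= /slope big_nil normr1.
move=> k l kl; rewrite -subset0 /S.
case: unliftP kl => [i ->|->]; case: unliftP => [j ->|->]; rewrite ?eqxx//.
- move=> ij u [[v _ <-]] [w _ [ji _]]; move: ij; by rewrite ji eqxx.
- by move=> _ u [[v _ <-]].
- by move=> _ u [-> [v _]].
Qed.

Lemma nelts_short_words_bounds : exists C c d : R, [/\ 0 < C, 0 < c &
  forall h, 1 <= h ->
    c * h `^ s - d <= (nelts (short_words h))%:R <= C * h `^ s].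
Proof.
have m1 : 0 < m%:R - 1 :> R by rewrite subr_gt0 ltr1n.
pose e : R := (m%:R - 1)^-1.
have e0 : 0 < e by rewrite invr_gt0.
pose M h : R := (nelts (short_words h))%:R + e.
have ME h : 1 <= h -> M h = \sum_(i < m) M (h / rho i).
  move=> h1; rewrite /M nelts_short_words// natrD natr_sum big_split /=.
  rewrite sumr_const card_ord -[e *+ m]mulr_natl /e; field.
  by rewrite gt_eqF.
have rmax_gt0 : 0 < rmax by exact: lt_le_trans rmax_ge1.
have M_small h : h < 1 -> M h <= e.
  move=> h1; rewrite /M gerDr (_ : short_words h = set0) ?/nelts ?fset_set0//.
  rewrite -subset0 => u /=; apply/negP; rewrite -ltNge; apply: lt_le_trans h1 _.
  rewrite (ler_int _ 1); apply: le_trans (norm_slope_ge r r_gt1 u).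
  by rewrite exprn_ege1.
exists (e * rmax `^ s), e, e; split => //.
  by rewrite mulr_gt0// powR_gt0.
move=> h h1; apply/andP; split.
  have := @superrecursion_ge R m rho s rmax rho_ge2 rho_le_sum (ltW s_gt0) rmax_ge1
    s_eq M e rmax^-1; rewrite mulVf ?gt_eqF// invr1.
  rewrite lerBlDr => /(_ _ _ _ _ h); rewrite mul1r; apply.
  - by rewrite invr_gt0.
  - exact: ltW.
  - by move=> h' _; rewrite lerDr.
  - by move=> h' h1'; rewrite -ME.
  - by apply: le_trans h1; rewrite invf_le1.
rewrite -mulrA -powRM ?(ltW rmax_gt0) ?(le_trans ler01 h1)//.
apply: (@le_trans _ _ (M h)); first by rewrite lerDl ltW.
apply: (subrecursion_le rho s rmax rho_ge2 rho_le_sum (ltW s_gt0) rmax_ge1 s_eq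
  unit (fun _ => M) e) => //.
- exact: ltW.
- by move=> _ h' h1'; exists (fun=> tt); rewrite ME.
- by apply: le_trans h1; rewrite invf_le1.
Qed.

(** The semigroup consists of the maps along nonempty words. *)
Lemma gen_semigroupE :
  gen_semigroup (rifs r b) = wcomp r b @` [set u | u != [::]].
Proof.
apply/seteqP; split=> [g|_ [u u0 <-]].
  elim=> [i|g1 g2 _ [u u0 <-] _ [v v0 <-]]; first by exists [:: i].
  exists (u ++ v); first by case: u u0.
  by apply/funext => x; rewrite /= wcomp_cat.
elim: u u0 => // i [|j u] IH _; first exact: (gen_base (rifs r b) i).
exact: (gen_comp (gen_base (rifs r b) i) (IH isT)).
Qed.

End Growth.

(** * Logarithmic ratios *)

Section LogRatio.
Context {R : realType}.
Local Open Scope ereal_scope.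

Lemma lne_ratio_le (C h s : R) (n : nat) : (0 < C)%R -> (1 < h)%R ->
  (n%:R <= C * h `^ s)%R -> lne n%:R%:E / (ln h)%:E <= (s + ln C / ln h)%:E.
Proof.
move=> C0 h1 nh; have lh : (0 < ln h)%R by exact: ln_gt0.
have h0 : (0 < h)%R by exact: lt_trans h1.
case: n nh => [_|n nh].
  by rewrite le0_lneNy// inver gt_eqF// gt0_mulNye ?leNye// lte_fin invr_gt0.
rewrite lne_EFin// inver gt_eqF// -EFinM lee_fin ler_pdivrMr//.
rewrite mulrDl divfK ?gt_eqF// addrC -ln_powR -lnM ?posrE ?powR_gt0//.
by rewrite ler_ln ?posrE// mulr_gt0// powR_gt0.
Qed.

Lemma lne_ratio_ge (c h s : R) (n : nat) : (0 < c)%R -> (1 < h)%R ->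
  (c * h `^ s <= n%:R)%R -> (s + ln c / ln h)%:E <= lne n%:R%:E / (ln h)%:E.
Proof.
move=> c0 h1 nh; have lh : (0 < ln h)%R by exact: ln_gt0.
have h0 : (0 < h)%R by exact: lt_trans h1.
have ch : (0 < c * h `^ s)%R by rewrite mulr_gt0// powR_gt0.
have n0 : (0 < n%:R :> R)%R by exact: lt_le_trans nh.
rewrite lne_EFin// inver gt_eqF// -EFinM lee_fin ler_pdivlMr//.
rewrite mulrDl divfK ?gt_eqF// addrC -ln_powR -lnM ?posrE ?powR_gt0//.
by rewrite ler_ln ?posrE// (le_trans nh).
Qed.

Lemma ln_cvgy : (ln x : R) @[x --> +oo%R] --> +oo%R.
Proof.
apply/cvgryPge => A; near=> x.
have Ax : (expR A <= x)%R by near: x; apply: nbhs_pinfty_ge; rewrite num_real.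
rewrite -[A]expRK ler_ln ?posrE ?expR_gt0//.
Unshelve. all: by end_near. Qed.

Lemma add_div_ln_cvg (a s : R) : (s + a / ln h)%R @[h --> +oo%R] --> s.
Proof.
rewrite -[X in _ --> X]addr0; apply: cvgD; first exact: cvg_cst.
rewrite -(mulr0 a); apply: cvgM; first exact: cvg_cst.
apply/gtr0_cvgV0.
  by near=> h; apply: ln_gt0; near: h; apply: nbhs_pinfty_gt; rewrite num_real.
exact: ln_cvgy.
Unshelve. all: by end_near. Qed.

(** A function squeezed between two functions [s + a / ln h] tends to [s]. *)
Lemma log_ratio_cvg (f : R -> \bar R) (a a' s : R) :
  (\forall h \near +oo%R, (s + a / ln h)%:E <= f h <= (s + a' / ln h)%:E) ->
  f h @[h --> +oo%R] --> s%:E.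
Proof.
move=> fa; apply: (squeeze_cvge fa).
  by apply: cvg_EFin; [exact: nearW|exact: add_div_ln_cvg].
by apply: cvg_EFin; [exact: nearW|exact: add_div_ln_cvg].
Qed.

Lemma cvg_limf_esup (f : R -> \bar R) (s : R) :
  f h @[h --> +oo%R] --> s%:E -> limf_esup f +oo%R = s%:E.
Proof.
move=> fs; rewrite limf_esupE.
have near_s (e : R) : (0 < e)%R ->
    \forall h \near +oo%R, (s - e)%:E <= f h <= (s + e)%:E.
  move=> e0; apply: (fs [set y | (s - e)%:E <= y <= (s + e)%:E]).
  exists e => //= y; rewrite /ball /= => yse.
  by move: yse; rewrite !lee_fin ltr_distlC => /andP[/ltW -> /ltW ->].
apply/eqP; rewrite eq_le; apply/andP; split.
  apply/lee_addgt0Pr => e e0; apply: ge_ereal_inf.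
  exists (ereal_sup (f @` [set h | f h <= (s + e)%:E])) => /=.
    exists [set h | f h <= (s + e)%:E] => //.
    by apply: filterS (near_s e e0) => h /= /andP[].
  by rewrite -EFinD; apply: ge_ereal_sup => _ [h fh <-].
apply/lee_subgt0Pr => e e0; apply: le_ereal_inf_tmp => _ [V FV <-].
have [h [Vh /andP[fh _]]] := filter_ex (filterI FV (near_s e e0)).
by rewrite -EFinB; apply: le_trans fh _; apply: ereal_sup_ubound; exists h.
Qed.

Lemma cvg_limf_einf (f : R -> \bar R) (s : R) :
  f h @[h --> +oo%R] --> s%:E -> limf_einf f +oo%R = s%:E.
Proof.
move=> fs; rewrite /limf_einf -[RHS]oppeK; congr (- _).
by rewrite -EFinN; apply: cvg_limf_esup; rewrite EFinN; apply: cvgeN fs.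
Qed.

End LogRatio.

(** * Mass and Beurling dimensions, and growth of the semigroup *)

Section MassBeurlingGrowth.
Context {R : realType} {m : nat} (r b : 'I_m -> int) (K : set int) (s : R).
Context (r_gt1 : forall i, 1 < `|r i|).
Context (K_invariant : invariant_set (rifs r b) K).
Context (f_nondegenerate : ~ degenerate (rifs r b)).
Context (K_overlaps : finite_overlaps (rifs r b) K).
Context (s_gt0 : 0 < s) (s_eq : \sum_(i < m) (`|r i|%:~R : R) `^ (- s) = 1).

Let near_gt1 : \forall h \near +oo, 1 < h :> R.
Proof. by apply: nbhs_pinfty_gt; rewrite num_real. Qed.

Lemma invariant_mass_dim : has_mass_dim K s%:E.
Proof.
have [C C0 upper] := (nelts_window_le r b K s r_gt1 K_invariant
  f_nondegenerate s_gt0 s_eq).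
have [c c0 lower] := nelts_window_ge r b K s r_gt1 K_invariant
  f_nondegenerate K_overlaps s_gt0 s_eq.
have : @mass_ratio R K h @[h --> +oo] --> s%:E.
  apply: (@log_ratio_cvg _ _ (ln c) (ln C)); near=> h.
  have h1 : 1 < h by near: h.
  rewrite /mass_ratio countingE; last exact: finite_in_window.
  apply/andP; split.
    by apply: lne_ratio_ge => //; near: h.
  apply: lne_ratio_le => //.
  by have := upper 0 h (ltW h1); rewrite sub0r add0r.
move=> ratio; split; [exact: cvg_limf_einf|exact: cvg_limf_esup].
Unshelve. all: by end_near. Qed.

Lemma invariant_beurling_dim : beurling_dim K = s%:E :> \bar R.
Proof.
have [C C0 upper] := (nelts_window_le r b K s r_gt1 K_invariant
  f_nondegenerate s_gt0 s_eq).
have [c c0 lower] := nelts_window_ge r b K s r_gt1 K_invariant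
  f_nondegenerate K_overlaps s_gt0 s_eq.
apply: cvg_limf_esup; apply: (@log_ratio_cvg _ _ (ln c) (ln C)); near=> h.
have h1 : 1 < h by near: h.
apply/andP; split; last first.
  apply: ge_ereal_sup => _ [x _ <-].
  rewrite countingE; last exact: finite_in_window.
  by apply: lne_ratio_le => //; apply: upper; exact: ltW.
apply: le_ereal_sup_tmp; eexists; first by exists 0; [|reflexivity].
rewrite countingE; last exact: finite_in_window.
rewrite sub0r add0r.
by apply: lne_ratio_ge => //; near: h.
Unshelve. all: by end_near. Qed.

(** By freeness the elements of the semigroup correspond to the nonempty words. *)
Lemma semigroup_growth : has_growth_exponent (rifs r b) s%:E.
Proof.
have [C [c [d [C0 c0 bounds]]]] := nelts_short_words_bounds r b K s r_gt1
  K_invariant f_nondegenerate s_gt0 s_eq.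
have free := wcomp_free r b r_gt1 K K_invariant f_nondegenerate K_overlaps.
have setE (h : R) : [set g | gen_semigroup (rifs r b) g /\
    (`|linear_coef g|%:~R <= h)%R] =
    wcomp r b @` (short_words r h `\ [::]).
  rewrite gen_semigroupE; apply/seteqP; split=> [_ [[u u0 <-]]|_ [u [uh u0] <-]].
    by rewrite linear_coef_wcomp => uh; exists u => //; split=> //; exact/eqP.
  by split; [exists u => //; exact/eqP|rewrite linear_coef_wcomp].
have fin (h : R) : finite_set (short_words r h `\ [::]).
  by apply: finite_setD; exact: finite_short_words.
apply: (@log_ratio_cvg _ _ (ln (c / 2)) (ln C)); near=> h.
have h1 : 1 < h by near: h.
rewrite /growth_ratio setE countingE; last exact/finite_image.
rewrite nelts_image//; have /andP[lower upper] := bounds h (ltW h1).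
have finh := finite_short_words r r_gt1 h.
have : (nelts (short_words r h) <= (nelts (short_words r h `\ [::])).+1)%N.
  rewrite -addn1 -(nelts1 _ ([::] : seq 'I_m)).
  pose S (k : 'I_2) := if k == ord0 then short_words r h `\ [::] else [set [::]].
  have -> : (nelts (short_words r h `\ [::]) + nelts [set [::] : seq 'I_m])%N =
      (\sum_(k < 2) nelts (S k))%N by rewrite !big_ord_recl big_ord0 addn0.
  apply: nelts_bigcup_le => [k|u uh]; first by rewrite /S; case: ifP.
  have [->|u0] := eqVneq u [::]; first by exists ord_max.
  by exists ord0 => //; split=> //; exact/eqP.
rewrite -(ler_nat R) -natr1 => words.
apply/andP; split.
  apply: lne_ratio_ge => //; first by rewrite divr_gt0.
  suff : d + 1 <= c / 2 * h `^ s by lra.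
  have c2 : 0 < c / 2 by rewrite divr_gt0.
  rewrite -ler_pdivrMl//; set a := _^-1 * _.
  apply: (@le_trans _ _ (Num.max a 0)); first by rewrite le_max lexx.
  rewrite -[leLHS]powRr1 ?le_max ?lexx ?orbT// -(mulVf (lt0r_neq0 s_gt0)) powRrM.
  apply: ge0_ler_powR; rewrite ?nnegrE ?powR_ge0 ?(ltW s_gt0)//.
apply: lne_ratio_le => //; apply: le_trans upper.
by rewrite ler_nat; apply: nelts_subset => // u [].
Unshelve. all: by end_near. Qed.

End MassBeurlingGrowth.

(** * Discrete intervals, shells and contents *)

Lemma discr_diam_eq (A : set int) (n : nat) : discr_diam_cands A n ->
  (forall k, discr_diam_cands A k -> (n <= k)%N) -> discr_diam A = n.
Proof.
move=> An least; rewrite /discr_diam; case: xgetP => [k _ [Ak leastk]|/(_ n)].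
  by apply/eqP; rewrite eqn_leq leastk// least.
by move=> none; exfalso; apply: none.
Qed.

Lemma discr_diam_interval x n : (0 < n)%N -> discr_diam (discr_interval x n) = n.
Proof.
move=> n0; apply: discr_diam_eq => [|k [k0 [y sub]]]; first by split => //; exists x.
have /sub /= : discr_interval x n x by rewrite /discr_interval /=; lia.
have /sub /= : discr_interval x n (x + n%:Z - 1) by rewrite /discr_interval /=; lia.
rewrite /discr_interval /=; lia.
Qed.

Lemma dyadic_windowE n y :
  dyadic_window n.+1 y <-> - (2 ^ n)%:Z <= y < (2 ^ n)%:Z.
Proof.
rewrite /dyadic_window /discr_centered /=.
have -> : (2 ^ n.+1)%:R / 2 = (2 ^ n)%N%:Z%:~R :> rat.
  by rewrite expnS natrM mulrAC divff// mul1r.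
by rewrite mulr0z sub0r add0r -mulrNz ler_int ltr_int.
Qed.

Lemma dyadic_shell_sub_window n : (0 < n)%N -> dyadic_shell n `<=` dyadic_window n.
Proof.
by case: n => [//|[|n]] _; rewrite /dyadic_shell//= => y [].
Qed.

Lemma dyadic_window_recE n : (0 < n)%N ->
  dyadic_window n.+1 = dyadic_window n `|` dyadic_shell n.+1.
Proof.
case: n => // n _; apply/seteqP; split=> [y wy|y [|[]//]].
  have [wy'|wy'] := pselect (dyadic_window n.+1 y); [by left|by right].
by move=> /dyadic_windowE wy; apply/dyadic_windowE; rewrite expnS; lia.
Qed.

Lemma dyadic_shell_sub_interval n : (0 < n)%N ->
  dyadic_shell n `<=` discr_interval (- (2 ^ n.-1)%:Z) (2 ^ n).
Proof.
move=> n0 y /(dyadic_shell_sub_window n n0); case: n n0 => // n _ /dyadic_windowE.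
by rewrite /discr_interval /= expnS; lia.
Qed.

(** The extreme points [- 2 ^ n.-1] and [2 ^ n.-1 - 1] of a window belong to the
    corresponding shell. *)
Lemma discr_diam_shell n : (0 < n)%N -> discr_diam (dyadic_shell n) = (2 ^ n)%N.
Proof.
move=> n0; apply: discr_diam_eq.
  split; first by rewrite expn_gt0.
  by eexists; exact: dyadic_shell_sub_interval.
move=> k [k0 [y sub]].
have extreme z : z = - (2 ^ n.-1)%:Z \/ z = (2 ^ n.-1)%:Z - 1 -> dyadic_shell n z.
  case: n n0 {sub} => [//|[|n]] _ hz.
    by rewrite /dyadic_shell leqnn; apply/dyadic_windowE; move: hz => /=; lia.
  rewrite /dyadic_shell /=; split.
    by apply/dyadic_windowE; move: hz; rewrite /= expnS; have := expn_gt0 2 n; lia.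
  move=> /dyadic_windowE; move: hz; rewrite /= expnS; have := expn_gt0 2 n; lia.
have /sub := extreme _ (or_introl erefl).
have /sub := extreme _ (or_intror erefl).
by case: n n0 {sub extreme} => // n _; rewrite /discr_interval /= expnS; lia.
Qed.

Lemma finite_discr_interval x n : finite_set (discr_interval x n).
Proof.
apply: (@sub_finite_set _ _ ((fun k : nat => x + k%:Z) @` `I_n)) => [y|].
  by rewrite /discr_interval /= => xy; exists `|y - x|%N => /=; lia.
exact/finite_image/finite_II.
Qed.

Lemma powR_invr (R : realType) (a t : R) : 0 <= a -> a^-1 `^ t = (a `^ t)^-1.
Proof. by move=> a0; rewrite -powR_inv1// -powRrM mulN1r powRN. Qed.

Section Content.
Context {R : realType}.
Implicit Types (A F : set int) (al : R).

(** The values of the covers over which [discr_content] is an infimum. *)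
Let values al A F : set R := [set v | exists (k : nat) (U : 'I_k -> set int),
    [/\ forall i, discr_intervals (U i),
        A `&` F `<=` \bigcup_(i : 'I_k) U i &
        v = \sum_(i < k)
              ((discr_diam (U i))%:R / (discr_diam F)%:R) `^ al]].

Let lbound_values al A F : lbound (values al A F) 0.
Proof. by move=> _ [k [U [_ _ ->]]]; apply: sumr_ge0 => i _; exact: powR_ge0. Qed.

(** Covering by singletons. *)
Let singletons al A F : finite_set F ->
  values al A F ((nelts (A `&` F))%:R * (discr_diam F)%:R^-1 `^ al).
Proof.
move=> finF; have finAF : finite_set (A `&` F) by exact: finite_setIr.
exists (nelts (A `&` F)).
exists (fun i : 'I_(nelts (A `&` F)) => discr_interval (nth 0 (fset_set (A `&` F)) i) 1).
split.
- by move=> i; eexists; exists 1%N.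
- move=> y AFy; have : y \in (fset_set (A `&` F) : seq int).
    by have := in_fset_set finAF y; rewrite mem_set.
  move=> yAF; have lt_i : (index y (fset_set (A `&` F)) < nelts (A `&` F))%N.
    by rewrite /nelts index_mem.
  by exists (Ordinal lt_i) => //=; rewrite /discr_interval /= nth_index//; lia.
rewrite (eq_bigr (fun=> (discr_diam F)%:R^-1 `^ al)).
  by rewrite sumr_const card_ord mulr_natl.
by move=> i _; rewrite discr_diam_interval// mul1r.
Qed.

Lemma discr_content_ge0 al A F : finite_set F -> 0 <= discr_content al A F.
Proof.
move=> finF; apply: lb_le_inf; last exact: lbound_values.
by eexists; exact: singletons.
Qed.

Lemma discr_content_le al A F : finite_set F ->
  discr_content al A F <= (nelts (A `&` F))%:R * (discr_diam F)%:R^-1 `^ al.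
Proof.
move=> finF; apply: ge_inf; last exact: singletons.
by exists 0; exact: lbound_values.
Qed.

(** Mass distribution principle: if every interval of length [n] meets [A] in at
    most [C n `^ s] points, the content of [A] in [F] is at least the number of
    points of [A] in [F] divided by the greatest number [C d `^ s] allowed by this
    bound, [d] being the diameter of [F]. *)
Lemma discr_content_ge (C s al : R) A F x : 0 < C -> 0 <= al -> al <= s ->
  (forall y n, (0 < n)%N -> (nelts (A `&` discr_interval y n))%:R <= C * n%:R `^ s) ->
  (0 < discr_diam F)%N -> F `<=` discr_interval x (discr_diam F) ->
  (nelts (A `&` F))%:R / (C * (discr_diam F)%:R `^ s) <= discr_content al A F.
Proof.
move=> C0 al0 als AC; set d := discr_diam F => d0 Fd.
have finF : finite_set F by apply: sub_finite_set Fd _; exact: finite_discr_interval.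
have dR : 0 < d%:R :> R by rewrite ltr0n.
have ds : 0 < C * d%:R `^ s by rewrite mulr_gt0// powR_gt0.
apply: lb_le_inf; first by eexists; exact: singletons.
move=> _ [k [U [UI AFU ->]]].
have [[i di]|small] := pselect (exists i, (d <= discr_diam (U i))%N).
  apply: (@le_trans _ _ 1).
    rewrite ler_pdivrMr// mul1r; apply: le_trans (AC x d d0).
    rewrite ler_nat; apply: nelts_subset; last exact: setIS.
    by apply: finite_setIr; exact: finite_discr_interval.
  rewrite (bigD1 i)//= -[leLHS]addr0; apply: lerD; last first.
    by apply: sumr_ge0 => j _; exact: powR_ge0.
  rewrite -[leLHS](powRr0 ((discr_diam (U i))%:R / d%:R)) ler_powR//.
  by rewrite ler_pdivlMr// mul1r ler_nat.
have {}small i : (discr_diam (U i) < d)%N.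
  by rewrite ltnNge; apply/negP => di; apply: small; exists i.
have AFUn : ((nelts (A `&` F)) <= \sum_(i < k) nelts (A `&` U i))%N.
  apply: nelts_bigcup_le => [i|y AFy].
    apply: finite_setIr; have [y [n [_ ->]]] := UI i.
    exact: finite_discr_interval.
  by have [i _ Uiy] := AFU y AFy; exists i => //; split => //; case: AFy.
rewrite ler_pdivrMr//; apply: (@le_trans _ _ (\sum_(i < k) nelts (A `&` U i))%:R).
  by rewrite ler_nat.
rewrite natr_sum mulr_suml; apply: ler_sum => i _.
have [y [n [n0 Ui]]] := UI i.
have := small i; rewrite Ui discr_diam_interval// => nd.
apply: le_trans (AC y n n0) _; rewrite mulrCA ler_pM2l//.
rewrite -ler_pdivrMr ?powR_gt0//.
have nR : 0 < n%:R :> R by rewrite ltr0n.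
have -> : n%:R `^ s / d%:R `^ s = (n%:R / d%:R) `^ s.
  by rewrite powRM ?invr_ge0 ?ler0n// powR_invr ?ler0n.
apply: ger_powR => //; rewrite divr_gt0//= ler_pdivrMr// mul1r ler_nat.
exact: ltnW.
Qed.

End Content.

(** * The discrete dimensions of an invariant set *)

Section DiscreteDimensions.
Context {R : realType}.

Lemma powR_exp2 (s : R) n : (2 ^ n)%N%:R `^ s = (2 `^ s) ^+ n.
Proof.
by rewrite natrX -powR_mulrn ?ler0n// powRAC powR_mulrn// powR_ge0.
Qed.

Lemma ltr_powR2 (t t' : R) : t < t' -> 2 `^ t < 2 `^ t'.
Proof. by move=> tt'; rewrite /powR gt_eqF// ltr_expR ltr_pM2r// ln_gt0// ltr1n. Qed.

(** A summable sequence tends to 0. *)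
Lemma nneseries_cvg0 (u : nat -> R) : (forall n, 0 <= u n) ->
  (\sum_(1 <= n <oo) (u n)%:E < +oo)%E -> u @ \oo --> 0.
Proof.
move=> u0 sumu; have uE0 n : (0 <= (u n)%:E)%E by rewrite lee_fin.
have sum0 : (\sum_(0 <= n <oo) (u n)%:E < +oo)%E.
  by rewrite nneseries_recl// lte_add_pinfty ?ltry.
have /fine_cvgP[fin_tail tail] := nneseries_tail_cvg sum0 (fun k _ => uE0 k).
apply: (squeeze_cvgr _ (cvg_cst 0) tail); near=> n.
rewrite u0 /= -lee_fin fineK; last by near: n.
apply: le_trans (nneseries_lim_ge n.+1 _) => //.
by rewrite big_nat1.
Unshelve. all: by end_near. Qed.

Lemma expr_unbounded (q A : R) : 1 < q -> \forall n \near \oo, A < q ^+ n.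
Proof.
move=> q1; have q0 : 0 < q by exact: lt_trans q1.
have : geometric A q^-1 @ \oo --> 0.
  by apply: cvg_geometric; rewrite ger0_norm ?invr_ge0 ?ltW// invf_lt1.
move=> /cvgrPdist_lt /(_ 1 ltr01); apply: filterS => n.
rewrite sub0r normrN /geometric /= exprVn => An.
have : A / q ^+ n < 1 by apply: le_lt_trans An; exact: ler_norm.
by rewrite ltr_pdivrMr ?exprn_gt0// mul1r.
Qed.

Context (K : set int) (s C c : R) (s_gt0 : 0 < s) (C_gt0 : 0 < C) (c_gt0 : 0 < c).
Context (upper : forall x h, 1 <= h ->
  (nelts (in_window K (x - h) (x + h)))%:R <= C * h `^ s).
Context (lower : \forall h \near +oo,
  c * h `^ s <= (nelts (in_window K (- h) h))%:R).

Lemma nelts_interval_le y n : (0 < n)%N ->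
  (nelts (K `&` discr_interval y n))%:R <= C * n%:R `^ s.
Proof.
move=> n0; have n1 : 1 <= n%:R :> R by rewrite ler1n.
apply: le_trans (upper y%:~R _ n1); rewrite ler_nat.
apply: nelts_subset; first exact: finite_in_window.
move=> k [Kk yk]; apply/in_windowP; split => //.
have : `|k - y| <= n%:Z by move: yk; rewrite /discr_interval /=; lia.
by rewrite -(ler_int R) intr_norm rmorphB.
Qed.

Lemma finite_dyadic_shell n : finite_set (dyadic_shell n).
Proof.
case: n => [|n]; last first.
  exact: sub_finite_set (dyadic_shell_sub_interval n.+1 isT)
    (finite_discr_interval _ _).
rewrite /dyadic_shell leq0n.
apply: sub_finite_set (dyadic_shell_sub_interval 1 isT) _.
exact: finite_discr_interval.
Qed.

(** The bound by singletons; it decays geometrically when [s < al]. *)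
Lemma shell_content_le (al : R) n : (0 < n)%N ->
  discr_content al K (dyadic_shell n) <= C * (2 `^ (s - al)) ^+ n.
Proof.
move=> n0; apply: le_trans (discr_content_le _ _ _ (finite_dyadic_shell n)) _.
rewrite discr_diam_shell// powR_invr ?ler0n// powR_exp2.
rewrite powRB ?pnatr_eq0 ?implybT// expr_div_n mulrA -exprVn exprVn.
rewrite ler_pM2r ?invr_gt0 ?exprn_gt0 ?powR_gt0//.
rewrite -powR_exp2; have := nelts_interval_le (- (2 ^ n.-1)%:Z) (2 ^ n).
rewrite expn_gt0 => /(_ isT); apply: le_trans; rewrite ler_nat.
apply: nelts_subset; first by apply: finite_setIr; exact: finite_discr_interval.
by apply: setIS; exact: dyadic_shell_sub_interval.
Qed.

Lemma shell_content_summable (al : R) : s < al ->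
  (\sum_(1 <= n <oo) (discr_content al K (dyadic_shell n))%:E < +oo)%E.
Proof.
move=> sal; have cont0 n : 0 <= discr_content al K (dyadic_shell n).
  by apply: discr_content_ge0; exact: finite_dyadic_shell.
set q : R := 2 `^ (s - al).
have q0 : 0 < q by exact: powR_gt0.
have q1 : q < 1.
  by have := ltr_powR2 (s - al) 0; rewrite powRr0 subr_lt0; apply.
apply: (@le_lt_trans _ _ (C * (1 - q)^-1)%:E); last exact: ltry.
apply: lime_le; first by apply: is_cvg_nneseries => n _ _; rewrite lee_fin.
near=> n; rewrite sumEFin lee_fin.
apply: le_trans (geometric_le_lim n (ltW C_gt0) q0 _); last by rewrite ger0_norm ?ltW.
rewrite /series /geometric /=; apply: (@le_trans _ _ (\sum_(1 <= k < n) C * q ^+ k)).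
  by apply: ler_sum_nat => k /andP[k1 _]; exact: shell_content_le.
have [->|n0] := posnP n; first by rewrite !big_geq.
by rewrite [leRHS]big_ltn// lerDr mulr_ge0 ?exprn_ge0// ltW.
Unshelve. all: by end_near. Qed.

(** The contents of the shells cannot tend to 0 below the exponent [s]: they
    would bound the numbers of points in the shells by a small multiple of
    [2 ^ n] to the power [s], and the sum of these numbers could not reach the
    growth of [K]. *)
Lemma shell_content_ncvg (al : R) : 0 <= al -> al < s ->
  ~ (discr_content al K (dyadic_shell n) @[n --> \oo] --> 0).
Proof.
move=> al0 als cont0.
pose q : R := 2 `^ s.
have q1 : 1 < q by have := ltr_powR2 0 s s_gt0; rewrite powRr0.
have q0 : 0 < q by exact: lt_trans q1.
pose a n : R := (nelts (K `&` dyadic_window n))%:R.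
pose D : R := c / q ^+ 2 / 2.
have D0 : 0 < D by rewrite !divr_gt0// exprn_gt0.
(* the value for which the geometric sum of the bounds is D *)
pose eps : R := D * (1 - q^-1) / C.
have eps0 : 0 < eps.
  by rewrite /eps divr_gt0// mulr_gt0// subr_gt0 invf_lt1.
move/cvgrPdist_lt: cont0 => /(_ eps eps0) [n0 _ small].
have shell n : (n0 <= n)%N -> (0 < n)%N ->
    (nelts (K `&` dyadic_shell n))%:R <= D * (1 - q^-1) * q ^+ n.
  move=> n0n n_gt0; have := small n n0n; rewrite /= sub0r normrN.
  rewrite ger0_norm ?discr_content_ge0//; last exact: finite_dyadic_shell.
  move=> /ltW /(le_trans (discr_content_ge _ _ _ _ _ _ C_gt0 al0 (ltW als)
    nelts_interval_le _ _)).
  rewrite discr_diam_shell// expn_gt0 => /(_ _ isT (dyadic_shell_sub_interval n n_gt0)).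
  rewrite powR_exp2 -/q ler_pdivrMr; last by rewrite mulr_gt0// exprn_gt0.
  by rewrite mulrA /eps divfK ?gt_eqF.
have fin n : finite_set (K `&` dyadic_window n.+1).
  apply: finite_setIr.
  apply: sub_finite_set (finite_discr_interval (- (2 ^ n)%:Z) (2 ^ n.+1)) => y.
  by move=> /dyadic_windowE; rewrite /discr_interval /= expnS; lia.
pose A := a n0.+1.
have bound k : a (n0.+1 + k)%N <= A + D * q ^+ (n0.+1 + k).
  elim: k => [|k IH]; first by rewrite addn0 lerDl mulr_ge0 ?exprn_ge0 ?ltW.
  rewrite addnS; set n := (n0.+1 + k)%N in IH *.
  have n_gt0 : (0 < n)%N by [].
  apply: (@le_trans _ _ (a n + (nelts (K `&` dyadic_shell n.+1))%:R)).
    rewrite /a -natrD ler_nat dyadic_window_recE// setIUr.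
    pose S (i : 'I_2) :=
      if i == ord0 then K `&` dyadic_window n else K `&` dyadic_shell n.+1.
    have -> : (nelts (K `&` dyadic_window n) + nelts (K `&` dyadic_shell n.+1))%N =
        (\sum_(i < 2) nelts (S i))%N by rewrite !big_ord_recl big_ord0 addn0.
    apply: nelts_bigcup_le => [i|y [ky|ky]]; last 2 first.
    - by exists ord0.
    - by exists ord_max.
    rewrite /S; case: ifP => _; first exact: fin.
    by apply: finite_setIr; exact: finite_dyadic_shell.
  have n0n : (n0 <= n.+1)%N by rewrite /n; lia.
  have sh := shell n.+1 n0n isT.
  apply: (le_trans (lerD IH sh)); rewrite -addrA lerD2l exprS -subr_ge0.
  rewrite (_ : _ - _ = 0)//; field.
  by rewrite gt_eqF.
have [M [_ lowerM]] := lower.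
have [N0 _ largeM] := expr_unbounded 2 M (ltr1n R 2).
have [N1 _ largeA] := expr_unbounded q (A / D) q1.
pose p := (n0.+1 + (N0 + N1))%N.
have := bound (N0 + N1 + 2)%N; rewrite addnA -/p addn2; apply/negP; rewrite -ltNge.
apply: (@lt_le_trans _ _ (2 * D * q ^+ p.+2)).
  have : A / D < q ^+ p.+2 by apply: largeA; rewrite /= /p; lia.
  by rewrite ltr_pdivrMr//; lra.
have -> : 2 * D * q ^+ p.+2 = c * (2 ^ p)%N%:R `^ s.
  rewrite powR_exp2 -/q /D -[p.+2]/(2 + p)%N exprD; move: (q ^+ p) => Q.
  by field; rewrite gt_eqF.
apply: (@le_trans _ _ (nelts (in_window K (- (2 ^ p)%N%:R) ((2 ^ p)%N%:R : R)))%:R).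
  by apply: lowerM; rewrite natrX; apply: largeM; rewrite /= /p; lia.
rewrite /a ler_nat; apply: nelts_subset; first exact: fin.
move=> k; rewrite /in_window => -[Kk /= kp]; split => //.
have {}kp : `|k| <= (2 ^ p)%N%:Z by rewrite -(ler_int R) intr_norm ler_norml.
apply/dyadic_windowE; move: kp; rewrite expnS; have := expn_gt0 2 p; lia.
Qed.

Lemma invariant_discr_dims :
  discr_lower_dim K = s%:E :> \bar R /\ discr_hausdorff_dim K = s%:E :> \bar R.
Proof.
have cont0 al n : 0 <= discr_content al K (dyadic_shell n) :> R.
  by apply: discr_content_ge0; exact: finite_dyadic_shell.
have sub : [set al : R | 0 <= al /\
    (\sum_(1 <= n <oo) (discr_content al K (dyadic_shell n))%:E < +oo)%E] `<=`
    [set al | 0 <= al /\ discr_content al K (dyadic_shell n) @[n --> \oo] --> 0].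
  by move=> al [al0 sum]; split => //; exact: nneseries_cvg0.
have lowerL : (s%:E <= discr_lower_dim K)%E.
  apply: le_ereal_inf_tmp => _ [al [al0 cont] <-].
  rewrite lee_fin leNgt; apply/negP => als.
  exact: shell_content_ncvg al0 als cont.
have LH : (discr_lower_dim K <= discr_hausdorff_dim K :> \bar R)%E.
  by apply: ereal_inf_le_tmp; exact: image_subset.
have upperH : (discr_hausdorff_dim K <= s%:E)%E.
  apply/lee_addgt0Pr => e e0; apply: ereal_inf_lbound.
  exists (s + e) => //; split; first by rewrite addr_ge0 ?ltW.
  by apply: shell_content_summable; rewrite ltrDl.
split; apply/eqP; rewrite eq_le.
  by rewrite lowerL (le_trans LH).
by rewrite upperH (le_trans lowerL).
Qed.

End DiscreteDimensions.

(** * The attractor of the inverse system *)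

Section InverseSystem.
Context {R : realType} {m : nat} (r b : 'I_m -> int).
Context (r_gt1 : forall i, 1 < `|r i|).

(** The maps of the system and of the inverse system on the real line. *)
Definition rfwd1 (i : 'I_m) (x : R) : R := (r i)%:~R * x + (b i)%:~R.
Definition rinv1 (i : 'I_m) (x : R) : R := (x - (b i)%:~R) / (r i)%:~R.

Lemma r_neq0 i : (r i)%:~R != 0 :> R.
Proof. by rewrite intr_eq0; have := r_gt1 i; apply: contraTneq => ->. Qed.

Lemma rinv1K i : cancel (rinv1 i) (rfwd1 i).
Proof. by move=> x; rewrite /rfwd1 /rinv1; field; exact: r_neq0. Qed.

Lemma rfwd1K i : cancel (rfwd1 i) (rinv1 i).
Proof. by move=> x; rewrite /rfwd1 /rinv1; field; exact: r_neq0. Qed.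

Lemma rinv1_image i (A : set R) : rinv1 i @` A = rfwd1 i @^-1` A.
Proof.
apply/seteqP; split=> [_ [x Ax <-]|x Ax]; first by rewrite /preimage /= rinv1K.
by exists (rfwd1 i x) => //; rewrite rfwd1K.
Qed.

Lemma rfwd1_continuous i : continuous (rfwd1 i).
Proof.
move=> x; apply: cvgD; last exact: cvg_cst.
by apply: cvgM; [exact: cvg_cst|exact: cvg_id].
Qed.

(** The Hutchinson operator of the inverse system. *)
Let T (A : set R) : set R := \bigcup_i rfwd1 i @^-1` A.

Let T_mono A B : A `<=` B -> T A `<=` T B.
Proof. by move=> AB x [i _ Ax]; exists i => //; exact: AB. Qed.

Let beta : R := \sum_(i < m) `|b i|%:~R.

Let b_le i : `|(b i)%:~R| <= beta.
Proof.
rewrite -intr_norm /beta (bigD1 i)//= lerDl.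
by apply: sumr_ge0 => j _; rewrite ler0z.
Qed.

Let J : set R := [set x | - beta <= x <= beta].

Let T_J : T J `<=` J.
Proof.
move=> x [i _]; rewrite /J /preimage /= -!ler_norml /rfwd1 => xJ.
have : `|(r i)%:~R * x| <= beta + beta.
  rewrite -[X in `|X|](addrK (b i)%:~R); apply: le_trans (ler_normB _ _) _.
  by apply: lerD => //; exact: b_le.
rewrite normrM; have r2 := @expansion_ge2 R m r r_gt1 i.
rewrite intr_norm in r2 => H; have := normr_ge0 x; nra.
Qed.

(** The attractor is the decreasing intersection of the iterates of an interval
    mapped into itself. *)
Lemma inverse_attractor_exists : (0 < m)%N ->
  exists X : set R, is_inverse_attractor r b X.
Proof.
move=> m0; pose A n := iter n T J.
have A_decr n : A n.+1 `<=` A n.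
  by elim: n => [|n IH]; [exact: T_J|exact: T_mono].
have A_le k n : (k <= n)%N -> A n `<=` A k.
  move=> /subnK <-; elim: (n - k)%N => [//|d IH].
  by apply: subset_trans IH; rewrite addSn; exact: A_decr.
have A_closed n : closed (A n).
  elim: n => [|n IH] /=.
    rewrite (_ : J = `[- beta, beta]%classic); first exact: interval_closed.
    by apply/seteqP; split => x; rewrite /J /= in_itv.
  apply: closed_bigcup => [|i _]; first exact: finite_finset.
  by apply: closed_comp => // x _; exact: rfwd1_continuous.
pose X := \bigcap_n A n.
have XJ : X `<=` J by move=> x /(_ 0%N I).
exists X; split.
- (* the fixed point of a map of the system lies in X *)
  pose i := Ordinal m0; pose x := - (b i)%:~R / ((r i)%:~R - 1) : R.
  have r1 : 1 <= `|(r i)%:~R - 1| :> R.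
    have -> : (r i)%:~R - 1 = (r i - 1)%:~R :> R by rewrite rmorphB.
    by rewrite -intr_norm (ler_int R 1); have := r_gt1 i; lia.
  have r1_neq0 : (r i)%:~R - 1 != 0 :> R by rewrite -normr_gt0 (lt_le_trans ltr01).
  have fx : rfwd1 i x = x by rewrite /rfwd1 /x; field.
  exists x => n _; elim: n => [|n IH]; last by exists i => //; rewrite /preimage /= fx.
  rewrite /A /J /= -ler_norml /x normrM normrN normfV.
  rewrite ler_pdivrMr ?(lt_le_trans ltr01)//; apply: le_trans (b_le i) _.
  by rewrite ler_peMr// (le_trans _ (b_le i)).
- apply: (subclosed_compact _ (segment_compact (a := - beta) (b := beta))).
    by apply: closed_bigI => n _; exact: A_closed.
  by move=> x /XJ; rewrite /J /= in_itv.
apply/seteqP; split=> [x Xx|x [i _]]; last first.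
  change ((rinv1 i @` X) x -> X x); rewrite rinv1_image => Xfx [|n] _.
    by apply: T_J; exists i => //; exact: XJ.
  by exists i => //; exact: Xfx.
apply: contrapT => nx.
have {}nx i : exists n, ~ A n (rfwd1 i x).
  apply/existsNP => Afx; apply: nx; exists i => //.
  by change ((rinv1 i @` X) x); rewrite rinv1_image => n _; exact: Afx.
have [n nxn] := choice nx.
have [i _ Afx] := Xx (\max_i n i).+1 I.
by apply: (nxn i); apply: A_le Afx; exact: leq_bigmax.
Qed.

End InverseSystem.

(** * Cylinders of the attractor *)

Section Words.
Context {R : realType} {m : nat} (r b : 'I_m -> int).
Context (r_gt1 : forall i, 1 < `|r i|).

(** All words of length [n]. *)
Fixpoint words (n : nat) : seq (seq 'I_m) :=
  if n is n'.+1 then [seq i :: u | i <- index_enum 'I_m, u <- words n'] else [:: [::]].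

(** The weight of a word: its contraction ratio to the power [t]. *)
Definition weight (t : R) (u : seq 'I_m) : R := `|slope r u|%:~R `^ (- t).

(** The composition of the inverse maps along a word, the first letter being
    applied last. *)
Definition rinv (u : seq 'I_m) (x : R) : R := foldr (rinv1 r b) x u.

Lemma mem_words n u : (u \in words n) = (size u == n).
Proof.
elim: n u => [|n IH] [|i u]//=.
- by apply/negbTE/negP => /allpairsP[[j v] []].
- rewrite eqSS -IH; apply/allpairsP/idP => [[[j v] /= [_ vn [_ ->]]]//|un].
  by exists (i, u); rewrite mem_index_enum.
Qed.

Lemma slope_gt0 u : 0 < `|slope r u|%:~R :> R.
Proof. by rewrite ltr0z normr_gt0 slope_neq0. Qed.

Lemma weight_ge0 t u : 0 <= weight t u. Proof. exact: powR_ge0. Qed.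

Lemma weight_cons t i u : weight t (i :: u) = (`|r i|%:~R : R) `^ (- t) * weight t u.
Proof.
by rewrite /weight slope_cons normrM rmorphM powRM ?ler0z.
Qed.

Lemma sum_weight_words t n :
  \sum_(u <- words n) weight t u = (\sum_(i < m) (`|r i|%:~R : R) `^ (- t)) ^+ n.
Proof.
elim: n => [|n IH].
  by rewrite big_seq1 /weight /slope big_nil normr1 powR1.
rewrite big_allpairs_dep exprS mulr_suml; apply: eq_bigr => i _.
by rewrite -IH mulr_sumr; apply: eq_bigr => u _; rewrite weight_cons.
Qed.

Lemma rinv_dist u x y : `|rinv u x - rinv u y| = `|x - y| / `|slope r u|%:~R.
Proof.
elim: u => [|i u IH]; first by rewrite /slope big_nil normr1 divr1.
rewrite /rinv /= -!/(rinv _ _) {1 2}/rinv1.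
rewrite -mulrBl opprB addrA subrK normrM IH slope_cons normrM rmorphM invfM.
by rewrite normfV -(@intr_norm R (r i)) [in RHS]mulrA mulrAC.
Qed.

Context (X : set R) (X_attractor : is_inverse_attractor r b X).

Let XE : X = \bigcup_i (rinv1 r b i @` X). Proof. by case: X_attractor. Qed.

Lemma rinv_attractor u x : X x -> X (rinv u x).
Proof.
by move=> Xx; elim: u => // i u IH; rewrite XE; exists i => //; exists (rinv u x).
Qed.

Lemma attractor_cylinders n : X `<=` [set x | exists2 u, u \in words n & (rinv u @` X) x].
Proof.
elim: n => [|n IH] x Xx; first by exists [::] => //; exists x.
move: Xx; rewrite {1}XE => -[i _ [y Xy <-]].
have [u un [z Xz <-]] := IH y Xy.
by exists (i :: u); [move: un; rewrite !mem_words /= eqSS|exists z].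
Qed.

Lemma attractor_bounded : exists2 D : R, 0 < D & forall x, X x -> `|x| <= D.
Proof.
case: X_attractor => _ /compact_bounded[M [_ /(_ (`|M| + 1))]] XM _.
exists (`|M| + 1); first by rewrite ltr_wpDl.
by apply: XM; rewrite (le_lt_trans (ler_norm _))// ltrDl.
Qed.

End Words.

(** * Upper bound for the Hausdorff dimension *)

Section Diameter.
Context {R : realType}.
Local Open Scope ereal_scope.

Lemma diameter_ge0 (U : set R) : U !=set0 -> 0 <= diameter U.
Proof.
move=> [x Ux]; apply: le_ereal_sup_tmp; exists 0%E => //.
by exists (x, x) => //=; rewrite subrr normr0.
Qed.

Lemma diameter_le (U : set R) (d : R) :
  (forall x y, U x -> U y -> (`|x - y| <= d)%R) -> diameter U <= d%:E.
Proof.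
by move=> Ud; apply: ge_ereal_sup => _ [[x y] [Ux Uy] <-]; rewrite lee_fin Ud.
Qed.

Lemma diameter_pow_ge0 (t : R) (U : set R) : 0 <= diameter_pow t U.
Proof. by rewrite /diameter_pow; case: ifP => // _; exact: poweR_ge0. Qed.

Lemma diameter_pow_le (t : R) (U : set R) (d : R) : (0 <= t)%R -> (0 <= d)%R ->
  diameter U <= d%:E -> diameter_pow t U <= (d `^ t)%:E.
Proof.
move=> t0 d0 Ud; rewrite /diameter_pow; case: ifPn => [_|/set0P U0].
  by rewrite lee_fin powR_ge0.
rewrite -poweR_EFin; apply: gt0_ler_poweR => //; rewrite in_itv /= leey andbT ?lee_fin//.
exact: diameter_ge0.
Qed.

End Diameter.

Section UpperBound.
Context {R : realType} {m : nat} (r b : 'I_m -> int) (X : set R) (s t : R).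
Context (r_gt1 : forall i, 1 < `|r i|) (m_gt1 : (1 < m)%N).
Context (X_attractor : is_inverse_attractor r b X).
Context (s_ge0 : 0 <= s) (s_eq : \sum_(i < m) (`|r i|%:~R : R) `^ (- s) = 1).

(** Covering the attractor by its cylinders of order [n]. *)
Lemma premeasure_attractor (delta : R) : 0 < delta -> s < t ->
  (hausdorff_premeasure t delta X <= 0)%E.
Proof.
move=> delta0 st; have t0 : 0 <= t by exact: le_trans (ltW st).
have [D0 D0_gt0 XD] := attractor_bounded r b X X_attractor.
pose D := D0 + D0; have D_gt0 : 0 < D by rewrite addr_gt0.
pose phi := \sum_(i < m) (`|r i|%:~R : R) `^ (- t).
have phi1 : phi < 1.
  by rewrite -s_eq; apply: sum_powRN_decreasing => // i; exact: expansion_ge2.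
have phi0 : 0 <= phi by apply: sumr_ge0 => i _; exact: powR_ge0.
have bound n : D / 2 ^+ n <= delta ->
    (hausdorff_premeasure t delta X <= (D `^ t * phi ^+ n)%:E)%E.
  move=> Dn.
  pose N := size (words n : seq (seq 'I_m)).
  pose U k := if (k < N)%N then rinv r b (nth [::] (words n) k) @` X else set0 : set R.
  have U_diam k : (k < N)%N ->
      (diameter (U k) <= (D / `|slope r (nth [::] (words n) k)|%:~R)%:E)%E.
    move=> kN; rewrite /U kN; apply: diameter_le => _ _ [x Xx <-] [y Xy <-].
    rewrite rinv_dist// ler_pM2r ?invr_gt0 ?slope_gt0//.
    by apply: le_trans (ler_normB _ _) _; apply: lerD; exact: XD.
  apply: ge_ereal_inf; exists (\sum_(0 <= k <oo) diameter_pow t (U k))%E.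
    exists U => //; split=> [x Xx|k].
      have [u un ux] := attractor_cylinders r b X X_attractor n x Xx.
      exists (index u (words n)) => //; rewrite /U index_mem un.
      by rewrite nth_index.
    have [kN|kN] := ltnP k N; last first.
      rewrite /U ltnNge kN /=; apply: diameter_le => ? ? [].
    apply: le_trans (U_diam k kN) _; rewrite lee_fin; apply: le_trans Dn.
    rewrite ler_pM2l// lef_pV2 ?posrE ?slope_gt0 ?exprn_gt0//.
    rewrite -[2]/(2%:~R) -rmorphXn /= ler_int.
    have : nth [::] (words n) k \in (words n : seq (seq 'I_m)) by exact: mem_nth.
    by rewrite mem_words => /eqP {1}<-; exact: norm_slope_ge.
  rewrite (nneseries_split 0 N); last by move=> k _; exact: diameter_pow_ge0.
  rewrite add0n [X in (_ + X)%E]eseries0 ?adde0; last first.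
    by move=> k kN _; rewrite /U ltnNge kN /diameter_pow eqxx.
  apply: (@le_trans _ _ (\sum_(k < N) (D `^ t * weight r t (nth [::] (words n) k))%:E)%E).
    rewrite big_mkord; apply: lee_sum => k _; have kN := ltn_ord k.
    apply: le_trans (diameter_pow_le _ _ _ t0 _ (U_diam k kN)) _.
      by rewrite divr_ge0 ?ltW// slope_gt0.
    rewrite lee_fin powRM ?(ltW D_gt0) ?invr_ge0 ?(ltW (slope_gt0 _ _ _))//.
    by rewrite powR_invr ?(ltW (slope_gt0 _ _ _))// /weight powRN.
  rewrite sumEFin lee_fin -mulr_sumr.
  by rewrite -sum_weight_words (big_nth [::]) big_mkord.
apply/lee_addgt0Pr => e e0; rewrite add0e.
have geo : geometric (D `^ t) phi @ \oo --> 0.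
  by apply: cvg_geometric; rewrite ger0_norm.
have geo2 : geometric D 2^-1 @ \oo --> 0.
  by apply: cvg_geometric; rewrite ger0_norm ?invr_ge0// invf_lt1// ltr1n.
near \oo => n.
apply: (@le_trans _ _ (D `^ t * phi ^+ n)%:E); last first.
  rewrite lee_fin; apply: le_trans (ler_norm _) _; rewrite -normrN -sub0r.
  by near: n; move/cvgrPdist_le : geo => /(_ e e0); apply.
apply: bound; apply: le_trans (ler_norm _) _; rewrite -normrN -sub0r -exprVn.
by near: n; move/cvgrPdist_le : geo2 => /(_ delta delta0); apply.
Unshelve. all: by end_near. Qed.

Lemma hausdorff_measure_attractor : s < t -> hausdorff_measure t X = 0%E.
Proof.
move=> st; apply/eqP; rewrite eq_le; apply/andP; split.
  by apply: ge_ereal_sup => _ [delta delta0 <-]; exact: premeasure_attractor.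
apply: le_ereal_sup_tmp; exists (hausdorff_premeasure t 1 X).
  by exists 1 => //=; exact: ltr01.
apply: le_ereal_inf_tmp => _ [U _ <-].
by apply: nneseries_ge0 => k _ _; exact: diameter_pow_ge0.
Qed.

End UpperBound.

(** * Lower bound for the Hausdorff dimension *)

Section BoundedWords.
Context {R : realType} {m : nat} (r b : 'I_m -> int).
Context (r_gt1 : forall i, 1 < `|r i|) (free : injective (wcomp r b)).

(** The inverse of [rinv r b u], a composition of maps of the system in which
    the first letter of [u] is applied first. *)
Definition rfwd (u : seq 'I_m) (x : R) : R :=
  (slope r u)%:~R * x + (wcomp r b (rev u) 0)%:~R.

Lemma rfwd_cons i u x : rfwd (i :: u) x = rfwd u (rfwd1 r b i x).
Proof.
rewrite /rfwd rev_cons -cats1 wcomp_cat wcompE slope_rev slope_cons.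
rewrite /wcomp /= /rifs mulr0 add0r -/(wcomp _ _ _ _) /rfwd1.
by rewrite rmorphD !rmorphM /=; ring.
Qed.

Lemma rfwd_rinv u v x : rfwd u (rinv r b (u ++ v) x) = rinv r b v x.
Proof.
elim: u => [|i u IH]; first by rewrite /rfwd /slope big_nil mul1r addr0.
by rewrite rfwd_cons /= rinv1K.
Qed.

Lemma rfwd_dist u x y : `|rfwd u x - rfwd u y| = `|slope r u|%:~R * `|x - y|.
Proof. by rewrite /rfwd opprD addrACA subrr addr0 -mulrBr normrM intr_norm. Qed.

(** Only polynomially many words of length at most [L] send [z] into a given
    bounded set: the linear coefficient of the map is determined by the numbers
    of occurrences of the letters, and its constant term is an integer varying in
    an interval of length [2 B], so it is determined by its residue. *)
Lemma size_bounded_words (S : seq (seq 'I_m)) (z : R) (B L : nat) : uniq S ->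
  (forall u, u \in S -> (size u <= L)%N /\ `|rfwd u z| <= B%:R) ->
  (size S <= L.+1 ^ m * (2 * B).+1)%N.
Proof.
move=> uniqS SB; pose Q := (2 * B).+1.
pose phi (u : seq 'I_m) : {ffun 'I_m -> 'I_L.+1} * 'I_Q :=
  ([ffun i => inord (count_mem i u)], inord `|(wcomp r b (rev u) 0%R %% Q%:Z)%Z|%N).
have phi_inj : {in S &, injective phi}.
  move=> u v uS vS [/ffunP eq_count eq_mod].
  have [Lu Bu] := SB u uS; have [Lv Bv] := SB v vS.
  have uv : perm_eq u v.
    apply/allP => i _ /=; apply/eqP; have := congr1 val (eq_count i); rewrite !ffunE /=.
    by rewrite !inordK// ltnS (leq_trans (count_size _ _)).
  have slope_uv : slope r u = slope r v by exact: perm_big.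
  apply: (can_inj revK); apply: free; apply/funext => x.
  rewrite (wcompE r b _ x) (wcompE r b (rev v) x) !slope_rev slope_uv; congr (_ + _).
  set cu := wcomp r b (rev u) 0 in eq_mod Bu *.
  set cv := wcomp r b (rev v) 0 in eq_mod Bv *.
  have Q0 : Q%:Z != 0 by [].
  have cuv : `|cu - cv| < Q%:Z.
    rewrite -(ltr_int R) intr_norm rmorphB /=.
    apply: (@le_lt_trans _ _ (B%:R + B%:R)).
      rewrite (_ : _ - _ = rfwd u z - rfwd v z).
        by apply: le_trans (ler_normB _ _) _; apply: lerD.
      by rewrite /rfwd slope_uv -/cu -/cv; ring.
    by rewrite -natrD addnn -mul2n ltr_nat.
  have modE c : `|(c %% Q%:Z)%Z|%N = (c %% Q%:Z)%Z :> int by rewrite gez0_abs ?modz_ge0.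
  have mod_lt c : (`|(c %% Q%:Z)%Z| < Q)%N.
    by rewrite -ltz_nat modE ltz_pmod.
  have : (cu == cv %[mod Q%:Z])%Z.
    have := congr1 val eq_mod; rewrite /= !inordK// => e.
    by apply/eqP; rewrite -(modE cu) -(modE cv) e.
  rewrite eqz_mod_dvd => /dvdzP[q e]; apply/eqP; rewrite -subr_eq0 e.
  have -> : q = 0; last by rewrite mul0r.
  have : `|q| * Q%:Z < 1 * Q%:Z.
    by rewrite mul1r -[Q%:Z in X in X < _]gtz0_abs// -normrM -e.
  by rewrite ltr_pM2r//; lia.
rewrite -(size_map phi); have uniq_phi : uniq (map phi S) by rewrite map_inj_in_uniq.
rewrite -(card_uniqP uniq_phi); apply: leq_trans (max_card _) _.
by rewrite card_prod card_ffun !card_ord.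
Qed.

End BoundedWords.

Section LowerBound.
Context {R : realType} {m : nat} (r b : 'I_m -> int) (X : set R) (s t : R).
Context (r_gt1 : forall i, 1 < `|r i|) (m_gt1 : (1 < m)%N).
Context (free : injective (wcomp r b)).
Context (X_attractor : is_inverse_attractor r b X).
Context (s_eq : \sum_(i < m) (`|r i|%:~R : R) `^ (- s) = 1).
Context (t_gt0 : 0 < t) (t_lt_s : t < s).

Lemma sum_weight1 n : \sum_(w <- words n) weight r s w = 1 :> R.
Proof. by rewrite sum_weight_words s_eq expr1n. Qed.

(** The words of length [n] with a given prefix weigh at most this prefix. *)
Lemma sum_weight_prefix n u :
  \sum_(w <- words n | prefix u w) weight r s w <= weight r s u :> R.
Proof.
elim: u n => [|i u IH] n.
  under eq_bigl => w do rewrite prefix0s.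
  by rewrite sum_weight1 /weight /slope big_nil normr1 powR1.
case: n => [|n]; first by rewrite /= big_cons big_nil /=; exact: weight_ge0.
rewrite big_mkcond big_allpairs_dep (bigD1 i)//= [X in _ + X]big1 ?addr0; last first.
  move=> j ji; rewrite big1// => w _.
  by rewrite (negbTE (_ : _ != _))// eq_sym.
under eq_bigr => w _ do rewrite eqxx /= weight_cons.
rewrite -big_mkcond -mulr_sumr weight_cons.
by apply: ler_wpM2l => //; exact: powR_ge0.
Qed.

Lemma sum_weight_le (P : pred (seq 'I_m)) (S : seq (seq 'I_m)) n :
  (forall w, w \in words n -> P w -> exists2 u, u \in S & prefix u w) ->
  \sum_(w <- words n | P w) weight r s w <= \sum_(u <- S) weight r s u :> R.
Proof.
move=> PS; apply: (@le_trans _ _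
  (\sum_(u <- S) \sum_(w <- words n | prefix u w) weight r s w)).
  under [leRHS]eq_bigr => u _ do rewrite big_mkcond.
  rewrite exchange_big big_mkcond /= big_seq [leRHS]big_seq; apply: ler_sum => w wn.
  have sum_ge0 (S' : seq (seq 'I_m)) :
      0 <= \sum_(u <- S') (if prefix u w then weight r s w else 0) :> R.
    by apply: sumr_ge0 => u _; case: ifP => // _; exact: weight_ge0.
  case: ifP => // Pw; have [u uS uw] := PS w wn Pw.
  rewrite (big_rem u)//= uw lerDl; exact: sum_ge0.
by apply: ler_sum => u _; exact: sum_weight_prefix.
Qed.

(** Exponentials dominate polynomials. *)
Lemma polynomial_le_expr (q : R) (a : nat) : 1 < q ->
  exists2 C : R, 0 < C & forall k, ((k + a)%N%:R : R) ^+ m <= C * q ^+ k.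
Proof.
move=> q1; have q0 : 0 < q by exact: lt_trans q1.
pose p := q `^ m%:R^-1.
have m0 : 0 < m%:R :> R by rewrite ltr0n ltnW.
have p1 : 1 < p.
  by rewrite /p /powR gt_eqF// expR_gt1 mulr_gt0 ?invr_gt0// ln_gt0.
have pm : p ^+ m = q.
  by rewrite -powR_mulrn ?powR_ge0// -powRrM mulVf ?gt_eqF// powRr1// ltW.
have bernoulli k : 1 + k%:R * (p - 1) <= p ^+ k.
  elim: k => [|k IH]; first by rewrite mul0r addr0.
  rewrite exprS -natr1; have k0 : 0 <= k%:R :> R by rewrite ler0n.
  have p_ge0 : 0 <= p by exact: ltW (lt_trans ltr01 p1).
  apply: le_trans (ler_wpM2l p_ge0 IH); rewrite -subr_ge0.
  rewrite (_ : _ - _ = k%:R * (p - 1) ^+ 2); last by ring.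
  by rewrite mulr_ge0// sqr_ge0.
pose c := a%:R + (p - 1)^-1.
have c0 : 0 < c by rewrite ltr_wpDl// invr_gt0 subr_gt0.
exists (c ^+ m); first exact: exprn_gt0.
move=> k; rewrite -pm -exprM mulnC exprM -exprMn.
apply: lerXn2r; rewrite ?nnegrE ?ler0n//.
  by rewrite mulr_ge0 ?exprn_ge0// ltW// (lt_trans ltr01).
apply: le_trans (ler_wpM2l (ltW c0) (bernoulli k)).
have d0 : 0 < p - 1 by rewrite subr_gt0.
rewrite natrD -subr_ge0.
rewrite (_ : _ - _ = a%:R * k%:R * (p - 1) + (p - 1)^-1); last first.
  by rewrite /c; field; rewrite gt_eqF.
by rewrite addr_ge0 ?invr_ge0 ?mulr_ge0 ?ler0n// ltW.
Qed.

Context (x0 : R) (Xx0 : X x0).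

(** The mass of a ball: the words under consideration have a prefix whose
    expansion is comparable with the inverse of the radius of the ball, and these
    prefixes send the centre of the ball into a bounded set. *)
Lemma ball_mass : exists2 C : R, 0 < C & forall z rad : R, 0 < rad ->
  exists n0, forall n, (n0 <= n)%N ->
    \sum_(w <- words n | `|z - rinv r b w x0| < rad) weight r s w <= C * rad `^ t.
Proof.
have [D D0 XD] := attractor_bounded r b X X_attractor.
pose k0 := (\sum_(i < m) `|r i|%N)%N.
have r_le i : `|r i| <= 2 ^+ k0.
  have : (`|r i| <= k0)%N by rewrite /k0 (bigD1 i)//= leq_addr.
  have := ltn_expl k0 (isT : (1 < 2)%N); rewrite -[2 ^+ k0]/((2%:Z) ^+ k0).
  by rewrite -natz -natrX natz; lia.
pose B := ((Num.trunc D).+1 + 2 ^ k0)%N.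
pose Q := (2 * B).+1.
have q1 : 1 < 2 `^ (s - t) :> R.
  by have := @ltr_powR2 R 0 (s - t); rewrite powRr0 subr_gt0; apply.
have [C1 C1_gt0 poly] := polynomial_le_expr _ k0.+1 q1.
have s_gt0 : 0 < s by exact: lt_trans t_lt_s.
have C2_ge0 : 0 <= C1 * Q%:R * 2 `^ t.
  by rewrite !mulr_ge0 ?powR_ge0// ?ler0n// ltW.
exists (1 + C1 * Q%:R * 2 `^ t); first by rewrite ltr_pwDl.
(* the summand 1 accounts for the balls of radius greater than 1 *)
move=> z rad rad0; have [rad1|rad1] := ltP 1 rad.
  exists 0%N => n _; apply: (@le_trans _ _ 1).
    rewrite -(sum_weight1 n) big_mkcond; apply: ler_sum => w _.
    by case: ifP => // _; exact: weight_ge0.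
  rewrite -[leLHS]mulr1; apply: ler_pM => //; first by rewrite lerDl.
  by rewrite -(powRr0 rad) ler_powR// ltW.
have [k [rad_gt rad_le]] : exists k, (2 ^+ k.+1)^-1 < rad /\ rad <= (2 ^+ k)^-1.
  have ex : exists k, (2 ^+ k.+1)^-1 < rad.
    have [k _ kP] := expr_unbounded 2 rad^-1 (ltr1n R 2).
    exists k; rewrite invf_plt ?posrE ?exprn_gt0//.
    by apply: kP; rewrite /= leqnSn.
  have [k kP kmin] := ex_minnP ex; exists k; split=> //.
  case: k kP kmin => [|k] _ kmin; first by rewrite expr0 invr1.
  by rewrite leNgt; apply/negP => /kmin; rewrite ltnn.
pose L := (k + k0)%N.
pose cond (u : seq 'I_m) := (2 ^+ k <= `|slope r u|) && (`|rfwd r b u z| <= B%:R).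
pose S := undup [seq u <- flatten [seq words j | j <- iota 0 L.+1] | cond u].
have SE u : (u \in S) = (size u <= L)%N && cond u.
  rewrite mem_undup mem_filter andbC; congr (_ && _); apply/flatten_mapP/idP.
    by move=> [j]; rewrite mem_iota ltnS mem_words /= => jL /eqP ->.
  by move=> uL; exists (size u); rewrite ?mem_iota ?ltnS ?mem_words.
exists k => n kn.
(* each word reaching the ball has a prefix in S: the shortest one whose expansion
   is at least 2 ^ k *)
have prefixes w : w \in words n -> `|z - rinv r b w x0| < rad ->
    exists2 u, u \in S & prefix u w.
  rewrite mem_words => /eqP wn wz.
  have wP : 2 ^+ k <= `|slope r (take (size w) w)|.
    rewrite take_size; apply: le_trans (norm_slope_ge r r_gt1 w).
    by rewrite wn ler_eXn2l.
  have ex : exists j, 2 ^+ k <= `|slope r (take j w)| by exists (size w).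
  have [j jP jmin] := ex_minnP ex.
  have jn : (j <= size w)%N by exact: jmin.
  exists (take j w); last exact: prefix_take.
  have size_u : size (take j w) = j by rewrite size_takel.
  have slope_le : `|slope r (take j w)| <= 2 ^+ L.
    case: j jP jmin jn {size_u} => [|j] jP jmin jn.
      by rewrite take0 /slope big_nil normr1 exprn_ege1.
    rewrite (take_nth (Ordinal (ltnW m_gt1)) jn) -cats1 /slope big_cat big_seq1.
    rewrite normrM exprD; apply: ler_pM => //.
    rewrite leNgt; apply/negP => /ltW /jmin; by rewrite ltnn.
  have z_slope : `|slope r (take j w)|%:~R <= (2 ^+ L : R).
    by rewrite -[2]/(2%:~R) -rmorphXn /= ler_int.
  rewrite SE size_u /cond jP /=; apply/andP; split.
    rewrite -(@leq_exp2l 2)// -(ler_nat int) !natrX.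
    by apply: le_trans slope_le; rewrite -{1}size_u; exact: norm_slope_ge.
  have rfwd_y : rfwd r b (take j w) (rinv r b w x0) = rinv r b (drop j w) x0.
    by rewrite -{2}(cat_take_drop j w) rfwd_rinv.
  rewrite -[rfwd _ _ _ _](subrK (rfwd r b (take j w) (rinv r b w x0))).
  apply: le_trans (ler_normD _ _) _; rewrite rfwd_dist rfwd_y natrD addrC; apply: lerD.
    apply: le_trans (XD _ _) _; first exact: rinv_attractor.
    exact: ltW (truncnS_gt _).
  apply: (@le_trans _ _ (2 ^+ L * (2 ^+ k)^-1)).
    by apply: ler_pM => //; rewrite ?ler0z// ltW// (lt_le_trans wz).
  by rewrite /L exprD mulrAC divff ?expf_neq0// mul1r natrX.
apply: (le_trans (sum_weight_le _ S n prefixes)).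
have k2 : 0 < (2 ^ k)%N%:R :> R by rewrite ltr0n expn_gt0.
have weight_S u : u \in S -> weight r s u <= ((2 ^ k)%N%:R `^ s)^-1.
  rewrite SE => /andP[_ /andP[ku _]]; rewrite /weight powRN.
  rewrite lef_pV2 ?posrE ?powR_gt0// ?slope_gt0//.
  apply: ge0_ler_powR; rewrite ?nnegrE ?(ltW s_gt0) ?ler0z ?(ltW k2)//.
  by rewrite natrX -[2]/(2%:~R) -rmorphXn /= ler_int.
apply: (@le_trans _ _ ((size S)%:R / (2 ^ k)%N%:R `^ s)).
  rewrite big_seq; apply: le_trans (ler_sum _ weight_S) _.
  by rewrite -big_seq big_const_seq count_predT iter_addr_0 mulr_natl.
have size_S : (size S)%:R <= C1 * (2 `^ (s - t)) ^+ k * Q%:R.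
  have S_bounded u : u \in S -> (size u <= L)%N /\ `|rfwd r b u z| <= B%:R.
    by rewrite SE => /andP[-> /andP[_ ->]].
  have := size_bounded_words r b free S z B L (undup_uniq _) S_bounded.
  rewrite -(ler_nat R) => /le_trans; apply.
  rewrite natrM ler_wpM2r ?ler0n// natrX -addnS; exact: poly.
rewrite ler_pdivrMr ?powR_gt0//; apply: (le_trans size_S).
have rad2 : ((2 ^ k)%N%:R `^ t)^-1 <= 2 `^ t * rad `^ t.
  rewrite -powRM ?ler0n ?(ltW rad0)// -powR_invr ?(ltW k2)//.
  apply: ge0_ler_powR; rewrite ?nnegrE ?invr_ge0 ?(ltW k2) ?(ltW t_gt0)//.
    by rewrite mulr_ge0 ?ler0n// ltW.
  move: (ltW rad_gt); rewrite natrX exprS invfM.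
  by rewrite ler_pdivrMl ?ltr0n.
have -> : C1 * 2 `^ (s - t) ^+ k * Q%:R =
    C1 * Q%:R * ((2 ^ k)%N%:R `^ t)^-1 * (2 ^ k)%N%:R `^ s.
  rewrite -powR_exp2 powRB ?gt_eqF ?implybT//.
  by field; rewrite gt_eqF// powR_gt0.
rewrite ler_pM2r ?powR_gt0//.
apply: (@le_trans _ _ (C1 * Q%:R * (2 `^ t * rad `^ t))).
  by apply: ler_wpM2l => //; rewrite mulr_ge0 ?ler0n// ltW.
by rewrite mulrA ler_wpM2r ?powR_ge0// lerDr.
Qed.

End LowerBound.

Section HausdorffDimension.
Context {R : realType} {m : nat} (r b : 'I_m -> int) (X : set R) (s : R).
Context (r_gt1 : forall i, 1 < `|r i|) (m_gt1 : (1 < m)%N).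
Context (free : injective (wcomp r b)).
Context (X_attractor : is_inverse_attractor r b X).
Context (s_gt0 : 0 < s) (s_eq : \sum_(i < m) (`|r i|%:~R : R) `^ (- s) = 1).

Lemma powRD_le (a a' t : R) : 0 <= a -> 0 <= a' -> 0 <= t ->
  (a + a') `^ t <= 2 `^ t * (a `^ t + a' `^ t).
Proof.
wlog aa' : a a' / a <= a' => [H a0 a'0 t0|].
  by have [|/ltW] := leP a a' => ?; [exact: H|rewrite addrC [X in _ * X]addrC; exact: H].
move=> a0 a'0 t0; apply: (@le_trans _ _ ((2 * a') `^ t)).
  by apply: ge0_ler_powR; rewrite ?nnegrE ?addr_ge0 ?mulr_ge0//; lra.
by rewrite powRM// ler_wpM2l ?powR_ge0// lerDr powR_ge0.
Qed.

Lemma sum_geometric_half (eta : R) N :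
  \sum_(0 <= i < N) eta / 2 ^+ i.+1 = eta - eta / 2 ^+ N.
Proof.
elim: N => [|N IH]; first by rewrite big_geq// expr0 divr1 subrr.
rewrite big_nat_recr//= IH exprS; field.
by rewrite expf_neq0.
Qed.

Lemma ler_sum_fset_nat (D : {fset nat}) (f : nat -> R) : (forall i, 0 <= f i) ->
  exists N, \sum_(i <- D) f i <= \sum_(0 <= i < N) f i.
Proof.
move=> f0; pose N := (\max_(i <- D) i).+1; exists N.
have D_perm : perm_eq D [seq i <- index_iota 0 N | i \in D].
  apply: uniq_perm; rewrite ?filter_uniq ?iota_uniq ?fset_uniq// => i.
  rewrite mem_filter mem_index_iota /= andbC; case iD: (i \in D); rewrite ?andbF//.
  by rewrite andbT /N ltnS leq_bigmax_seq.
rewrite (perm_big _ D_perm) big_filter big_mkcond; apply: ler_sum => i _.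
by case: ifP.
Qed.

(** The masses of the balls containing the sets of a cover of small
    [t]-dimensional size add up to less than 1. *)
Lemma hausdorff_measure_neq0 (t0 : R) : 0 <= t0 -> t0 < s ->
  hausdorff_measure t0 X != 0%E.
Proof.
move=> t0_ge0 t0s; apply/eqP => H0.
(* the masses of balls are controlled for positive exponents only, while t0
   may be 0 *)
pose t := Num.max t0 (s / 2).
have t_gt0 : 0 < t by rewrite lt_max divr_gt0 ?orbT.
have t_lt_s : t < s by rewrite gt_max t0s; lra.
have t0t : t0 <= t by rewrite le_max lexx.
have [[x0 Xx0] X_compact _] := X_attractor.
have [C C0 mass] := ball_mass r b X s t r_gt1 m_gt1 free X_attractor s_eq
  t_gt0 t_lt_s x0 Xx0.
have t2 : 0 < 2 `^ t :> R by rewrite powR_gt0.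
(* with this bound on the cover, the masses of the balls add up to at most 1 / 2 *)
pose eta := (4 * (C * 2 `^ t))^-1.
have eta0 : 0 < eta by rewrite invr_gt0 !mulr_gt0.
have : (hausdorff_premeasure t0 1 X < eta%:E)%E.
  apply: (@le_lt_trans _ _ 0%E); last by rewrite lte_fin.
  by rewrite -H0; apply: ereal_sup_ubound; exists 1 => //=; exact: ltr01.
move=> /ereal_inf_lt[_ [U [XU U1] <-] sumU].
pose d i : R := if U i == set0 then 0 else fine (diameter (U i)).
have dE i : U i !=set0 -> diameter (U i) = (d i)%:E.
  move=> U0; rewrite /d ifF ?fineK//; last by apply/negbTE/set0P.
  rewrite fin_numElt (lt_le_trans _ (diameter_ge0 _ U0)) ?ltNyr//.
  exact: le_lt_trans (U1 i) (ltry _).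
have d01 i : 0 <= d i <= 1.
  have [Ui|/set0P Ui] := eqVneq (U i) set0; first by rewrite /d Ui eqxx lexx ler01.
  by rewrite -!lee_fin -dE// diameter_ge0// U1.
have d0 i : 0 <= d i by have /andP[] := d01 i.
have d_pow i : ((d i `^ t)%:E <= diameter_pow t0 (U i))%E.
  rewrite /diameter_pow; have [Ui|Ui] := eqVneq (U i) set0.
    by rewrite /d Ui eqxx powR0// gt_eqF.
  rewrite dE; last exact/set0P.
  rewrite poweR_EFin lee_fin; have [->|di] := eqVneq (d i) 0.
    by rewrite powR0 ?gt_eqF// powR_ge0.
  by apply: ger_powR => //; rewrite lt_neqAle eq_sym di; exact: d01.
(* the sets, which may be points, are enlarged to open balls *)
pose e i : R := (eta / 2 ^+ i.+1) `^ t^-1.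
have e_arg i : 0 < eta / 2 ^+ i.+1 by rewrite divr_gt0// exprn_gt0.
have e0 i : 0 < e i by exact: powR_gt0.
have e_pow i : e i `^ t = eta / 2 ^+ i.+1.
  by rewrite /e -powRrM mulVf ?gt_eqF// powRr1// ltW.
pose y i := xget 0 (U i).
pose rad i := d i + e i.
have rad0 i : 0 < rad i by rewrite ltr_wpDl.
have X_balls : X `<=` cover setT (fun i => ball (y i) (rad i)).
  move=> x /XU[i _ Uix]; exists i => //; rewrite /ball /=.
  have Uiy : U i (y i) by apply: xgetI Uix.
  apply: (@le_lt_trans _ _ (d i)); last by rewrite ltrDl.
  rewrite -lee_fin -dE; last by exists x.
  by apply: ereal_sup_ubound; exists (y i, x).
move: X_compact; rewrite compact_cover.
move=> /(_ nat setT _ (fun i _ => @ball_open R R^o (y i) (rad i)) X_balls)[D _ XD].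
have [n0 n0P] := choice (fun i => mass (y i) (rad i) (rad0 i)).
pose n := (\max_(i <- D) n0 i)%N.
have total : 1 <= \sum_(i <- D) C * rad i `^ t.
  rewrite -(sum_weight1 r s s_eq n).
  apply: (@le_trans _ _ (\sum_(i <- D)
      \sum_(w <- words n | `|y i - rinv r b w x0| < rad i) weight r s w)); last first.
    rewrite big_seq [leRHS]big_seq; apply: ler_sum => i iD.
    by apply: n0P; exact: leq_bigmax_seq.
  under [leRHS]eq_bigr => i _ do rewrite big_mkcond.
  rewrite exchange_big /=; apply: ler_sum => w _.
  have [i iD iw] := XD _ (rinv_attractor r b X X_attractor w x0 Xx0).
  rewrite (big_rem i)//= ifT//; rewrite lerDl; apply: sumr_ge0 => j _.
  by case: ifP => // _; exact: weight_ge0.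
have [N DN] := ler_sum_fset_nat D (fun i => C * rad i `^ t)
  (fun i => mulr_ge0 (ltW C0) (powR_ge0 _ _)).
have sum_d : \sum_(0 <= i < N) d i `^ t <= eta.
  rewrite -lee_fin -sumEFin; apply: le_trans (ltW sumU).
  apply: le_trans (nneseries_lim_ge N _); last by move=> *; exact: diameter_pow_ge0.
  by apply: lee_sum => i _; exact: d_pow.
have sum_e : \sum_(0 <= i < N) e i `^ t <= eta.
  under eq_bigr do rewrite e_pow.
  by rewrite sum_geometric_half gerBl divr_ge0 ?exprn_ge0// ltW.
have : \sum_(0 <= i < N) C * rad i `^ t <= C * 2 `^ t * (eta + eta).
  apply: (@le_trans _ _ (C * 2 `^ t *
      (\sum_(0 <= i < N) d i `^ t + \sum_(0 <= i < N) e i `^ t))).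
    rewrite -big_split mulr_sumr; apply: ler_sum => i _ /=.
    rewrite -mulrA ler_pM2l//; by apply: powRD_le => //; exact: ltW.
  by rewrite ler_pM2l ?mulr_gt0//; exact: lerD.
have -> : C * 2 `^ t * (eta + eta) = 2^-1.
  by rewrite /eta; field; rewrite !gt_eqF.
move=> /(le_trans DN) /(le_trans total); apply/negP.
by rewrite -ltNge invf_lt1// ltr1n.
Qed.

Lemma hausdorff_dim_attractor : hausdorff_dim X = s%:E.
Proof.
apply/eqP; rewrite eq_le; apply/andP; split.
  apply/lee_addgt0Pr => e e0; apply: ereal_inf_lbound; exists (s + e) => //=.
  split; first by rewrite addr_ge0 ?ltW.
  apply: (hausdorff_measure_attractor r b X s) => //; first exact: ltW.
  by rewrite ltrDl.
apply: le_ereal_inf_tmp => _ [t [t0 Ht] <-]; rewrite lee_fin leNgt; apply/negP => ts.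
by have := hausdorff_measure_neq0 t t0 ts; rewrite Ht eqxx.
Qed.

End HausdorffDimension.

(** * All the dimensions agree *)

Theorem corollary6p3 (R : realType) (m : nat) (r b : 'I_m -> int)
    (K : set int)
    (r_gt1 : forall i, 1 < `|r i|)
    (f_distinct : injective (rifs r b))
    (f_nondegenerate : ~ degenerate (rifs r b))
    (K_invariant : invariant_set (rifs r b) K)
    (K_overlaps : finite_overlaps (rifs r b) K) :
  exists s : R,
    unique (fun t : R => \sum_(i < m) (`|r i|%:~R : R) `^ (- t) = 1) s /\
    discr_lower_dim K = s%:E /\
    discr_hausdorff_dim K = s%:E /\
    hausdorff_dim (inverse_attractor r b) = s%:E /\
    has_mass_dim K s%:E /\
    beurling_dim K = s%:E /\
    has_growth_exponent (rifs r b) s%:E.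

Proof.
have m_gt1 := system_size_gt1 r b r_gt1 K K_invariant f_nondegenerate.
have [s [s_gt0 s_unique]] := similarity_dimension
  (fun i => `|r i|%:~R : R) (expansion_ge2 R r r_gt1) m_gt1.
exists s; split=> //.
have s_eq : \sum_(i < m) (`|r i|%:~R : R) `^ (- s) = 1 by case: s_unique.
have [C C0 upper] := nelts_window_le r b K s r_gt1 K_invariant f_nondegenerate
  s_gt0 s_eq.
have [c c0 lower] := nelts_window_ge r b K s r_gt1 K_invariant f_nondegenerate
  K_overlaps s_gt0 s_eq.
have [dimL dimDH] := invariant_discr_dims K s C c s_gt0 C0 c0 upper lower.
split=> //; split=> //; split.
  apply: (hausdorff_dim_attractor r b) => //.
    exact: wcomp_free r_gt1 K K_invariant f_nondegenerate K_overlaps.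
  (* the attractor is given by choice, so its existence is what is needed *)
  apply: xgetPex; exact: inverse_attractor_exists (ltnW m_gt1).
split; first exact: (invariant_mass_dim r b K s r_gt1 K_invariant f_nondegenerate
    K_overlaps s_gt0 s_eq).
split; first exact: (invariant_beurling_dim r b K s r_gt1 K_invariant f_nondegenerate
    K_overlaps s_gt0 s_eq).
exact: (semigroup_growth r b K s r_gt1 K_invariant f_nondegenerate
  K_overlaps s_gt0 s_eq).
Qed.
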